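(* For every sufficiently large prime $p$ and every even integer $s\in[0.318p,\frac{p-1}{3}]$, the number of symmetric complete sum-free sets of the form $S_T\subseteq\mathbb{Z}_p$ that have size $s$ and satisfy $s\in S_T$ is $\Theta(2^{(p-3s)/6})$. That is, there are absolute constants $c_1,c_2>0$ and $p_0$ such that for every prime $p\ge p_0$ and every such $s$, this number lies between $c_1 2^{(p-3s)/6}$ and $c_2 2^{(p-3s)/6}$.
   Context: A set $S\subseteq\mathbb{Z}_p$ is sum-free if there are no $x,y,z\in S$ with $x+y=z$ (not necessarily distinct); symmetric if $x\in S$ implies $-x\in S$; complete if every element of $\mathbb{Z}_p\setminus S$ is a sum of two (not necessarily distinct) elements of $S$. Given $p$ and an even $s$ as in the statement, let $t=(p-3s+1)/2$ (a positive integer). For a set of integers $T\subseteq[0,2t-1]=\{0,1,\ldots,2t-1\}$, define $$S_T=[p-2s+1,2s-1]\cup\pm(s+T)\subseteq\mathbb{Z}_p,$$ where $[p-2s+1,2s-1]$ denotes the integer interval reduced modulo $p$ and $\pm(s+T)=\{s+x\mid x\in T\}\cup\{-(s+x)\mid x\in T\}$ modulo $p$. The sets counted are the sets $S_T$ over all $T\subseteq[0,2t-1]$; one has $|S_T|=s$ if and only if $|T|=t$, and $s\in S_T$ if and only if $0\in T$. *)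

(* Defs.v *)
From mathcomp Require Import all_boot all_order all_algebra.

Set Implicit Arguments.
Unset Strict Implicit.
Unset Printing Implicit Defensive.

Import GRing.Theory.

Local Open Scope ring_scope.

(* 'Z_p is the ring of integers modulo p as soon as 1 < p. *)

Definition sum_free (p : nat) (S : {set 'Z_p}) : bool :=
  ~~ [exists x in S, exists y in S, exists z in S, x + y == z].

Definition symmetric_set (p : nat) (S : {set 'Z_p}) : bool :=
  [forall x in S, - x \in S].

Definition complete_set (p : nat) (S : {set 'Z_p}) : bool :=
  [forall z in ~: S, exists x in S, exists y in S, z == x + y].

(* Used only when s is even, p is odd and 3 * s <= p - 1: the truncated
   subtraction and the division by 2 are then exact. *)
Definition half_width (p s : nat) : nat := ((p - 3 * s + 1) %/ 2)%N.

(* The integer interval [p - 2s + 1, 2s - 1] reduced modulo p; the natural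
   number subtraction is exact when 2 * s <= p. *)
Definition middle_interval (p s : nat) : {set 'Z_p} :=
  [set (k : nat)%:R | k : 'I_(2 * s) & (p - 2 * s + 1 <= k)%N].

(* A set of integers T included in [0, 2t - 1] is a {set 'I_(2 * t)}. *)
Definition S_of (p s : nat) (T : {set 'I_(2 * half_width p s)}) : {set 'Z_p} :=
  middle_interval p s
    :|: ([set (s + x)%N%:R | x : 'I_(2 * half_width p s) in T]
           :|: [set - (s + x)%N%:R | x : 'I_(2 * half_width p s) in T]).

Definition counted_sets (p s : nat) : {set {set 'Z_p}} :=
  [set S in [set @S_of p s T | T : {set 'I_(2 * half_width p s)}]
     | [&& symmetric_set S, complete_set S, sum_free S,
           #|S| == s & s%:R \in S]].

(* Main.v *)
(* Write p = 3s + F with F = 2t - 1.  Modulo p, a sum of two elements of S_T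
   meets S_T only through relations a + b + c = F in T, so S_T is sum-free iff
   no such relation holds.  As 0 is in T and |T| = t, this forces
   "x in T iff F - x not in T", hence T is closed under addition inside [0, F];
   conversely every such T yields a complete set.  So one counts the symmetric
   numerical semigroups with Frobenius number F, and has to show (Backelin)
   that there are Theta(2^(F/6)) of them.

   The part of T in (F/3, F/2) may be chosen freely if T has no other positive
   element below F/2; this gives the lower bound and accounts for the main term
   of the upper bound.  Otherwise let m <= F/3 be the least positive element of T
   and e = F - 3m; each m is shown to contribute O(poly(e) 2^(F/6 - e/2400)),
   which is summable.
   - If T has many elements q in [m, F/3 - e/600], each of them forbids
     x, F - x - q in T.  Branching on an x which forbids many undecided elements
     costs little, and when no such x is left the shifts by the q's bound the
     number of undecided elements.
   - If T has few elements there and m is not too small, these elements can be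
     listed, and the relation v + w <> F - m saves a factor 3/4 for each pair
     (v, w) in (F/3 - e/600, F/2).
   - If m < F/60, T is determined by its least elements in the residue classes
     modulo m. *)

Require Import Defs.
From mathcomp Require Import all_boot all_order all_algebra.
From mathcomp Require Import reals exp.
From mathcomp Require Import zify ring lra.

Set Implicit Arguments.
Unset Strict Implicit.
Unset Printing Implicit Defensive.

Import Order.TTheory GRing.Theory Num.Theory.

(** * Truncated symmetric numerical semigroups *)

Local Open Scope nat_scope.

(** Stated on naturals and false from n on, so that sums and differences of elements need no ordinal
    bounds. *)
Definition memn n (T : {set 'I_n}) (k : nat) : bool :=
  [exists x in T, x == k :> nat].

Arguments memn : simpl never.

Lemma memnP n (T : {set 'I_n}) k :
  reflect (exists2 x : 'I_n, x \in T & x = k :> nat) (memn T k).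
Proof.
by apply: (iffP exists_inP) => -[x xT /eqP xk]; exists x; rewrite // ?xk.
Qed.

Lemma memn_val n (T : {set 'I_n}) (x : 'I_n) : memn T x = (x \in T).
Proof.
by apply/memnP/idP => [[y yT /val_inj <-]|xT]; last exists x.
Qed.

Lemma memn_ord n (T : {set 'I_n}) k (kn : k < n) : memn T k = (Ordinal kn \in T).
Proof. by rewrite -memn_val. Qed.

Lemma memn_lt n (T : {set 'I_n}) k : memn T k -> k < n.
Proof. by case/memnP => x _ <-. Qed.

Lemma memn_inj n (T1 T2 : {set 'I_n}) :
  (forall k, k < n -> memn T1 k = memn T2 k) -> T1 = T2.
Proof. by move=> eqT; apply/setP => x; rewrite -!memn_val eqT. Qed.

Lemma memn_set n (P : pred nat) k :
  memn [set x : 'I_n | P x] k = (k < n) && P k.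
Proof.
apply/memnP/andP => [[x]|[kn Pk]]; first by rewrite inE => Px <-.
by exists (Ordinal kn); rewrite ?inE.
Qed.

Lemma card_ord_interval n a b :
  b <= n -> #|[set x : 'I_n | a <= x < b]| = b - a.
Proof.
move=> bn; have lt_n (j : 'I_(b - a)) : a + j < n by have := ltn_ord j; lia.
rewrite -[RHS]card_ord -(@card_imset _ _ (fun j => Ordinal (lt_n j))).
  apply: eq_card => x; rewrite inE; apply/idP/imsetP => [xab|[j _ ->]].
    have jP : x - a < b - a by lia.
    by exists (Ordinal jP) => //; apply: val_inj => /=; lia.
  by have := ltn_ord j; rewrite /=; lia.
by move=> i j [] /addnI /val_inj.
Qed.

(** A symmetric numerical semigroup with Frobenius number F = 2t - 1, cut down to [0, F]; all
    integers above F are implicitly elements. *)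
Definition symmetric_semigroup t (T : {set 'I_(2 * t)}) : bool :=
  [&& memn T 0,
      [forall x in T, forall y in T, (x + y < 2 * t) ==> memn T (x + y)] &
      [forall x : 'I_(2 * t), memn T x == ~~ memn T ((2 * t).-1 - x)]].

Lemma symmetric_semigroupP t (T : {set 'I_(2 * t)}) :
  reflect [/\ memn T 0,
              forall a b, memn T a -> memn T b -> a + b < 2 * t -> memn T (a + b) &
              forall a, a < 2 * t -> memn T a = ~~ memn T ((2 * t).-1 - a)]
          (symmetric_semigroup T).
Proof.
apply: (iffP and3P) => -[T0 Tadd Tsym]; split=> //.
- move=> a b /memnP[x xT <-] /memnP[y yT <-] xy.
  by move: Tadd => /forall_inP/(_ x xT)/forall_inP/(_ y yT)/implyP; apply.
- by move=> a an; move/forallP/(_ (Ordinal an))/eqP: Tsym.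
- apply/forall_inP => x xT; apply/forall_inP => y yT; apply/implyP.
  by apply: Tadd; rewrite memn_val.
- by apply/forallP => x; rewrite Tsym.
Qed.

(** * Undecided points of a family and branching *)

Definition undecided (X : finType) (G : {set {set X}}) : {set X} :=
  [set x | [exists T in G, x \in T] && [exists T in G, x \notin T]].

Lemma undecidedP (X : finType) (G : {set {set X}}) x :
  reflect ((exists2 T, T \in G & x \in T) /\ (exists2 T, T \in G & x \notin T))
          (x \in undecided G).
Proof.
rewrite inE; apply: (iffP andP).
  by case=> /exists_inP[T TG xT] /exists_inP[T' TG' xT']; split; [exists T|exists T'].
by case=> -[T TG xT] [T' TG' xT']; split; apply/exists_inP; [exists T|exists T'].
Qed.

Lemma undecidedS (X : finType) (G G' : {set {set X}}) :
  G \subset G' -> undecided G \subset undecided G'.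
Proof.
move=> /subsetP GG'; apply/subsetP => x /undecidedP[[T TG xT] [T' TG' xT']].
by apply/undecidedP; split; [exists T|exists T']; rewrite ?GG'.
Qed.

Local Open Scope ring_scope.

(* Branch on a point x whose presence decides more than phi further points: the
   recurrence is f w <= f (w - 1) + f (w - 1 - phi), solved by lam ^+ w. *)
Lemma branching_bound (R : realFieldType) (X : finType) (lam B : R) (phi : nat)
    (G0 : {set {set X}}) :
  1 <= lam -> 0 <= B -> lam ^+ phi + 1 <= lam ^+ phi.+1 ->
  (forall G : {set {set X}}, G \subset G0 ->
     (forall x, x \in undecided G ->
       (#|undecided G| <= #|undecided [set T in G | x \in T]| + phi)%N) ->
     #|G|%:R <= B) ->
  forall G : {set {set X}}, G \subset G0 -> #|G|%:R <= lam ^+ #|undecided G| * B.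
Proof.
move=> lam1 B0 Hphi Hstop G.
have [w] := ubnP #|undecided G|; elim: w G => // w IHw G Gw GG0.
have lamp k : 1 <= lam ^+ k by apply: exprn_ege1.
have [/forall_inP stop|] := boolP [forall x in undecided G,
   (#|undecided G| <= #|undecided [set T in G | x \in T]| + phi)%N].
  apply: le_trans (Hstop _ GG0 stop) _.
  by rewrite -[leLHS]mul1r ler_wpM2r.
rewrite negb_forall => /existsP[x]; rewrite negb_imply -ltnNge => /andP[xW lt_w].
(* With x in, more than phi points become decided; with x out, at least x itself does. *)
set G1 := [set T in G | x \in T] in lt_w *.
set G2 := [set T in G | x \notin T].
have G1G : G1 \subset G by apply/subsetP => T; rewrite inE => /andP[].
have G2G : G2 \subset G by apply/subsetP => T; rewrite inE => /andP[].
have cG : #|G| = (#|G1| + #|G2|)%N.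
  rewrite -[LHS](cardsID [set T : {set X} | x \in T] G); congr (_ + _)%N; apply: eq_card => T.
    by rewrite !inE.
  by rewrite !inE andbC.
have w2 : (#|undecided G2| < #|undecided G|)%N.
  apply: proper_card; rewrite properE undecidedS //; apply/subsetPn; exists x => //.
  by apply/undecidedP => -[[T TG xT] _]; move: TG; rewrite inE xT andbF.
have b2 := IHw G2 ltac:(lia) (subset_trans G2G GG0).
have b1 := IHw G1 ltac:(lia) (subset_trans G1G GG0).
rewrite cG natrD; apply: le_trans (lerD b1 b2) _.
rewrite -mulrDl ler_wpM2r //.
(* The two branches contribute at most lam^k + lam^(k + phi) = lam^k (1 + lam^phi) <= lam^(k + phi +
   1). *)
have [k kE] : exists k, #|undecided G| = (k + phi.+1)%N.
  by exists (#|undecided G| - phi.+1)%N; lia.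
apply: (@le_trans _ _ (lam ^+ k + lam ^+ (k + phi))).
  by apply: lerD; apply: ler_weXn2l => //; lia.
rewrite kE !exprD -[X in X + _]mulr1 -mulrDr ler_wpM2l //.
  by apply: le_trans (lamp k).
by rewrite addrC.
Qed.

(** * Undecided points in a class of fixed multiplicity *)

Local Open Scope nat_scope.

Definition multiplicity_class t m : {set {set 'I_(2 * t)}} :=
  [set T | [&& symmetric_semigroup T, memn T m &
               [forall x in T, (x == 0 :> nat) || (m <= x)]]].

Lemma multiplicity_classP t m (T : {set 'I_(2 * t)}) :
  reflect [/\ symmetric_semigroup T, memn T m &
              forall a, memn T a -> 0 < a -> m <= a]
          (T \in multiplicity_class t m).
Proof.
rewrite inE; apply: (iffP and3P) => -[sT Tm Tge]; split=> //.
  move=> a /memnP[x xT <-] x0; move/forall_inP/(_ x xT): Tge.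
  by rewrite -[x == _ :> nat]negbK -lt0n x0.
apply/forall_inP => x xT; case: (posnP x) => // x0.
by rewrite Tge ?orbT // memn_val.
Qed.

(* With F = 2t - 1: the points x for which neither x nor F - x can take part in a
   relation a + b + c = F between elements that are at least m. *)
Definition free_zone t m : {set 'I_(2 * t)} :=
  [set x : 'I_(2 * t) | 2 * t - 2 * m <= x < 2 * m].

Lemma memn_undecided n (G : {set {set 'I_n}}) k :
  memn (undecided G) k =
  [&& k < n, ~~ [forall T in G, memn T k] & ~~ [forall T in G, ~~ memn T k]].
Proof.
case: (ltnP k n) => [kn|]; last by apply: contraTF => /memn_lt; rewrite -ltnNge.
rewrite memn_ord andTb; apply/undecidedP/andP => [[[T TG xT] [T' TG' xT']]|[]].
  split; apply/forall_inPn; [exists T'|exists T] => //.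
    by rewrite memn_ord.
  by rewrite memn_ord negbK.
move=> /forall_inPn[T TG xT] /forall_inPn[T' TG' xT']; rewrite negbK in xT'.
by split; [exists T'|exists T]; rewrite // -memn_ord.
Qed.

(** The shift by u is injective and pushes at most u points of [0, n) past n - 1. *)
Lemma card_shift_le n (D E : {set 'I_n}) u :
  (forall x : 'I_n, x \in D -> x + u < n -> memn E (x + u)) ->
  #|D| <= #|E| + u.
Proof.
move=> DE; rewrite -(cardsID [set x : 'I_n | x + u < n] D); apply: leq_add.
  pose sh (x : 'I_n) := odflt x (insub (x + u)).
  have shE (x : 'I_n) : x + u < n -> sh x = x + u :> nat.
    by move=> xn; rewrite /sh; case: insubP => [y _ <-|]; rewrite ?xn.
  rewrite -(@card_in_imset _ _ sh).
    apply: subset_leq_card; apply/subsetP => z /imsetP[x /setIP[xD]].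
    by rewrite inE => xn ->; rewrite -memn_val shE // DE.
  move=> x y /setIP[_]; rewrite inE => xn /setIP[_]; rewrite inE => yn /(congr1 val) /=.
  by rewrite !shE // => /addIn /val_inj.
apply: leq_trans (_ : #|[set x : 'I_n | n - u <= x < n]| <= u).
  apply: subset_leq_card; apply/subsetP => x; rewrite !inE => /andP[xn _].
  by have := ltn_ord x; lia.
by rewrite card_ord_interval //; lia.
Qed.

(** As u is in every member, x in T forces F - x - u out of T; the points counted are the undecided
    x for which this decides no undecided point. Their shifts by u are decided in, as are the shifts
    of the points decided in, and a shift loses at most u points. *)
Lemma undecided_shift_bound t m u (G : {set {set 'I_(2 * t)}}) :
  0 < m -> 3 * m < 2 * t -> G \subset multiplicity_class t m -> G != set0 ->
  0 < u -> 3 * u < 2 * t -> (forall T, T \in G -> memn T u) ->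
  [disjoint undecided G & free_zone t m] ->
  #|[set x in undecided G |
      ~~ ((x + u < 2 * t) && memn (undecided G) ((2 * t).-1 - (x + u)))]|
    + #|free_zone t m| <= u.
Proof.
move=> m0 m3 /subsetP Gm /set0Pn[T0 T0G] u0 u3 Gu WZ.
set n := 2 * t in m3 G Gm T0 T0G u3 Gu WZ *.
set W := undecided G in WZ *; set Z := free_zone t m in WZ *.
set Wu := [set x in W | _].
pose aI k := [forall T in G, memn T k]; pose aO k := [forall T in G, ~~ memn T k].
have WE k : memn W k = [&& k < n, ~~ aI k & ~~ aO k] by rewrite memn_undecided.
have I0 : aI 0.
  by apply/forall_inP => T /Gm /multiplicity_classP[/symmetric_semigroupP[]].
have Iu : aI u by apply/forall_inP.
have Iadd a b : aI a -> aI b -> a + b < n -> aI (a + b).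
  move=> /forall_inP Ia /forall_inP Ib ab; apply/forall_inP => T TG.
  have /multiplicity_classP[/symmetric_semigroupP[_ Tadd _] _ _] := Gm T TG.
  by apply: Tadd; rewrite ?Ia ?Ib.
have Isym a : a < n -> aI a = aO (n.-1 - a).
  move=> an; apply: eq_forallb_in => T TG.
  have /multiplicity_classP[/symmetric_semigroupP[_ _ Tsym] _ _] := Gm T TG.
  exact: Tsym.
have IO a : aI a -> aO a -> False.
  by move=> /forall_inP Ia /forall_inP Oa; have := Oa _ T0G; rewrite Ia.
have Om a : 0 < a -> a < m -> aO a.
  move=> a0 am; apply/forall_inP => T TG; apply/negP => Ta.
  by have /multiplicity_classP[_ _ /(_ a Ta a0)] := Gm T TG; rewrite leqNgt am.
have Osym a : a < n -> aO a = aI (n.-1 - a).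
  move=> an; have an1 : n.-1 - a < n by lia.
  by rewrite Isym // subKn //; lia.
have ZE k : memn Z k = (k < n) && (n - 2 * m <= k < 2 * m).
  by rewrite (memn_set n (fun k => n - 2 * m <= k < 2 * m)).
have ZIO k : memn Z k -> aI k || aO k.
  move=> Zk; have := Zk; rewrite ZE => /andP[kn _]; apply/negPn/negP; rewrite negb_or => nIO.
  have: memn W k by rewrite WE kn.
  case/memnP => x xW xk; move: Zk; rewrite -xk memn_val => xZ.
  by move/disjoint_setI0/setP/(_ x): WZ; rewrite in_setI in_set0 xW xZ.
pose I := [set x : 'I_n | aI x].
pose OZ := [set x : 'I_n | aO x && memn Z x].
pose E := [set x : 'I_n | aI x && ~~ memn Z x].
have WuE x : x \in Wu -> [/\ ~~ aI x, ~~ aO x & ~~ ((x + u < n) && memn W (n.-1 - (x + u)))].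
  by rewrite inE -{1}memn_val WE => /andP[/and3P[]].
(* I and OZ are the points decided in, and decided out within the free zone: the
   shift by u sends I, Wu and OZ to points that are decided in and outside the
   free zone, or beyond 2t - 1. *)
have key : #|I :|: Wu :|: OZ| <= #|E| + u.
  apply: card_shift_le => x xD xun;
  rewrite (memn_set n (fun k => aI k && ~~ memn Z k)) xun andTb.
  have xn := ltn_ord x.
  have um : m <= u by rewrite leqNgt; apply/negP => /(Om _ u0) /(IO _ Iu).
  move: xD; rewrite in_setU in_setU -orbA => /or3P[|/WuE[xI xO xW]|].
  - rewrite inE => xI; rewrite Iadd // andTb ZE; case: (posnP x) => [x0|x0]; first by lia.
    have xm : m <= x by rewrite leqNgt; apply/negP => /(Om _ x0) /(IO _ xI).
    by lia.
  (* The point y = F - x - u is decided. Were it in, F - x = y + u would be in and x decided out. So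
     y is out and x + u = F - y is in; x >= m and u >= m place it beyond the free zone. *)
  - have ynlt : n.-1 - (x + u) < n by lia.
    have: aI (n.-1 - (x + u)) || aO (n.-1 - (x + u)).
      by move: xW; rewrite xun WE ynlt /= negb_and !negbK.
    case/orP => [yI|yO].
      case/negP: xO; rewrite Osym //.
      have -> : n.-1 - x = n.-1 - (x + u) + u by lia.
      by apply: Iadd => //; lia.
    rewrite Isym // yO andTb ZE.
    have x0 : 0 < x by rewrite lt0n; apply: contraNneq xI => ->.
    have xm : m <= x by rewrite leqNgt; apply: contra xO; apply: Om.
    by lia.
  (* Here F - (x + u) lies strictly between 0 and m, hence is out; it is nonzero because x < 2m <=
     2F/3 and u <= F/3. *)
  - rewrite inE ZE => /and3P[xO _ xZ].
    have yI : aI (x + u).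
      rewrite Isym //; apply: Om; last by lia.
      rewrite subn_gt0; suff : x + u != n.-1 by lia.
      by apply/eqP => xuE; move: xZ; lia.
    by rewrite yI andTb ZE; lia.
have cD : #|I :|: Wu :|: OZ| = #|I| + #|Wu| + #|OZ|.
  rewrite !cardsU.
  have -> : I :&: Wu = set0.
    apply/setP => x; rewrite in_setI in_set0; apply/negP => /andP[xI /WuE[/negP]].
    by move: xI; rewrite inE.
  have -> : (I :|: Wu) :&: OZ = set0.
    apply/setP => x; rewrite in_setI in_setU in_set0; apply/negP => /andP[xIW].
    rewrite inE => /andP[xO _]; case/orP: xIW => [|/WuE[_ /negP]] //.
    by rewrite inE => /IO.
  by rewrite cards0 !subn0.
have cI : #|I| = #|I :&: Z| + #|E|.
  rewrite -(cardsID Z I); congr (_ + _); apply: eq_card => x.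
  by rewrite in_setD [x \in I]inE [RHS]inE memn_val andbC.
have cZ : #|Z| = #|I :&: Z| + #|OZ|.
  rewrite -(cardsID I Z) setIC; congr (_ + _); apply: eq_card => x.
  rewrite [RHS]inE in_setD memn_val; case xZ: (x \in Z); rewrite ?andbF // !andbT inE.
  have := ZIO x; rewrite memn_val xZ => /(_ isT) /orP[xI|xO].
    by rewrite xI; apply/esym/negP => /IO; apply.
  by rewrite xO; apply/negP => /IO; apply.
(* Cancel |E| on both sides of [key]; the remaining |I :&: Z| + |OZ| is |Z|. *)
by move: key; rewrite cD cI cZ; move: #|Wu| #|I :&: Z| #|OZ| #|E| => *; lia.
Qed.

(* Double counting of the pairs (q, x) such that x in T forbids the undecided
   point F - x - q. *)
Lemma undecided_stop_bound t m u0 phi (Q : {set 'I_(2 * t)})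
    (G : {set {set 'I_(2 * t)}}) :
  0 < m -> 3 * m < 2 * t -> G \subset multiplicity_class t m -> G != set0 ->
  3 * u0 < 2 * t ->
  (forall q, q \in Q -> 0 < q <= u0) -> (forall T, T \in G -> Q \subset T) ->
  [disjoint undecided G & free_zone t m] ->
  (forall x, x \in undecided G ->
     #|undecided G| <= #|undecided [set T in G | x \in T]| + phi) ->
  #|undecided G| * #|Q| + #|Q| * #|free_zone t m| <=
    #|undecided G| * phi + #|Q| * u0.
Proof.
move=> m0 m3 Gm G0 u3 Qu QG WZ stop.
set n := 2 * t in Q G m3 Gm G0 u3 Qu QG WZ stop *.
set W := undecided G in WZ stop *; set Z := free_zone t m in WZ *.
pose b (q x : 'I_n) := (x + q < n) && memn W (n.-1 - (x + q)).
have stepW x : x \in W -> #|[set q in Q | b q x]| <= phi.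
  move=> xW; pose f (q : 'I_n) : 'I_n := odflt q (insub (n.-1 - (x + q))).
  have fE (q : 'I_n) : x + q < n -> f q = n.-1 - (x + q) :> nat.
    move=> xqn; rewrite /f; case: insubP => [y _ <-|] //=.
    by case/negP; lia.
  rewrite -(@card_in_imset _ _ f); last first.
    move=> q q'; rewrite !inE => /and3P[_ qn _] /and3P[_ qn' _] /(congr1 val) /=.
    by rewrite !fE // => eqq; apply: val_inj => /=; lia.
  (* Both x and q in T give x + q in T, so [f q] is decided out once x is in. *)
  apply: leq_trans (_ : #|W :\: undecided [set T in G | x \in T]| <= phi).
    apply: subset_leq_card; apply/subsetP => z /imsetP[q].
    rewrite inE => /and3P[qQ qn bq] ->; rewrite in_setD -!memn_val fE // bq andbT.
    rewrite memn_undecided negb_and negb_and !negbK.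
    apply/orP; right; apply/orP; right; apply/forall_inP => T.
    rewrite inE => /andP[TG xT].
    have /multiplicity_classP[/symmetric_semigroupP[_ Tadd Tsym] _ _] := subsetP Gm T TG.
    have Txq : memn T (x + q).
      by apply: Tadd => //; rewrite memn_val // (subsetP (QG T TG)).
    by move: (Tsym _ qn); rewrite Txq => /esym.
  rewrite cardsD (setIidPr _); last first.
    by apply: undecidedS; apply/subsetP => T; rewrite inE => /andP[].
  by rewrite leq_subLR stop.
have stepQ q : q \in Q -> #|[set x in W | ~~ b q x]| + #|Z| <= u0.
  move=> qQ; case/andP: (Qu q qQ) => q0 qu.
  have q3 : 3 * q < n by lia.
  by apply: leq_trans qu; apply: undecided_shift_bound => // T TG;
    rewrite memn_val (subsetP (QG T TG)).
have: \sum_(q in Q) (#|[set x in W | ~~ b q x]| + #|Z|) +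
      \sum_(x in W) #|[set q in Q | b q x]| <= #|Q| * u0 + #|W| * phi.
  apply: leq_add; rewrite -sum_nat_const; apply: leq_sum => i; [exact: stepQ|exact: stepW].
suff <- : \sum_(q in Q) #|[set x in W | ~~ b q x]| + \sum_(x in W) #|[set q in Q | b q x]|
          = #|W| * #|Q|.
  by rewrite big_split /= sum_nat_const addnAC [X in _ <= X -> _]addnC.
have -> : \sum_(x in W) #|[set q in Q | b q x]| = \sum_(q in Q) #|[set x in W | b q x]|.
  under eq_bigr do rewrite -sum1_card.
  under [RHS]eq_bigr do rewrite -sum1_card.
  rewrite (exchange_big_dep (mem Q)) /=; last by move=> x q _; rewrite inE => /andP[].
  apply: eq_bigr => q qQ; apply: eq_bigl => x; rewrite !inE qQ //.
rewrite -big_split /= mulnC -sum_nat_const; apply: eq_bigr => q _.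
rewrite -(cardsID [set x | b q x] W) addnC; congr (_ + _); apply: eq_card => x.
  by rewrite !inE.
by rewrite !inE andbC.
Qed.

(** Undecided points lie in [m, F - m]; off the free zone they fall into two intervals of length 2t
    - 3m. *)
Lemma card_undecided_le t m (G : {set {set 'I_(2 * t)}}) :
  0 < m -> 3 * m < 2 * t -> G \subset multiplicity_class t m ->
  [disjoint undecided G & free_zone t m] ->
  #|undecided G| <= 2 * (2 * t - 3 * m).
Proof.
move=> m0 m3 /subsetP Gm WZ.
have geW x : x \in undecided G -> m <= x < 2 * t - m.
  case/undecidedP => -[T TG xT] [T' TG' xT'].
  have /multiplicity_classP[/symmetric_semigroupP[_ _ _] _ Tge] := Gm T TG.
  have /multiplicity_classP[/symmetric_semigroupP[T0 _ Tsym] _ Tge'] := Gm T' TG'.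
  have x0 : 0 < x by rewrite lt0n; apply: contraNneq xT' => x0; rewrite -memn_val x0.
  rewrite -memn_val in xT; rewrite -memn_val in xT'.
  rewrite Tge //=; have xn := ltn_ord x.
  move: xT'; rewrite Tsym // negbK => xT'.
  have [|x1] := posnP ((2 * t).-1 - x); last by have := Tge' _ xT' x1; lia.
  move=> x1; have xE : x = (2 * t).-1 :> nat by lia.
  have /multiplicity_classP[/symmetric_semigroupP[T0' _ Tsym'] _ _] := Gm T TG.
  by move: (Tsym' _ xn); rewrite xT x1 T0'.
have sW : undecided G \subset [set x : 'I_(2 * t) | m <= x < 2 * t - 2 * m] :|:
    [set x : 'I_(2 * t) | 2 * m <= x < 2 * t - m].
  apply/subsetP => x xW; have := geW x xW.
  have : x \notin free_zone t m by rewrite (disjointFr WZ xW).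
  by rewrite !inE; lia.
apply: leq_trans (subset_leq_card sW) _; apply: leq_trans (leq_card_setU _ _) _.
by rewrite !card_ord_interval; lia.
Qed.

Definition lower_half t : {set 'I_(2 * t)} := [set x : 'I_(2 * t) | x < t].

Lemma card_sym_set t (X : {set 'I_(2 * t)}) :
  (forall x, x \in X -> memn X ((2 * t).-1 - x)) ->
  #|X| = 2 * #|X :&: lower_half t|.
Proof.
move=> Xsym; rewrite [RHS]mul2n -addnn -(cardsID (lower_half t) X); congr (_ + _).
have XE x : (rev_ord x \in X) = (x \in X).
  apply/idP/idP => /Xsym /=; last by rewrite -memn_val /=; congr (memn X _); lia.
  have -> : (2 * t).-1 - (2 * t - x.+1) = x by have := ltn_ord x; lia.
  by rewrite memn_val.
rewrite -(card_imset _ (can_inj (@rev_ordK _))); apply: eq_card => x.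
apply/imsetP/setIP => [[y /setDP[yX yH] ->]|[xX xH]].
  by rewrite XE yX; split=> //; move: yH; rewrite !inE /=; have := ltn_ord y; lia.
exists (rev_ord x); last by rewrite rev_ordK.
by rewrite in_setD XE xX andbT; move: xH; rewrite !inE /=; have := ltn_ord x; lia.
Qed.

(** A member is determined by its trace on the undecided points below t; the reflection of x to F -
    x gives the rest and halves the exponent. *)
Lemma card_symmetric_family t (G : {set {set 'I_(2 * t)}}) :
  (forall T, T \in G -> symmetric_semigroup T) ->
  #|G| <= 2 ^ #|undecided G :&: lower_half t| /\
  #|undecided G| = 2 * #|undecided G :&: lower_half t|.
Proof.
move=> Gs; set H := lower_half t; set W := undecided G.
have Gsym T x : T \in G -> x < 2 * t -> memn T x = ~~ memn T ((2 * t).-1 - x).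
  by move=> /Gs /symmetric_semigroupP[_ _ Tsym]; apply: Tsym.
split; last first.
  apply: card_sym_set => x /undecidedP[[T TG xT] [T' TG' xT']].
  rewrite -memn_val in xT; rewrite -memn_val in xT'.
  have xn := ltn_ord x.
  have xn' : (2 * t).-1 - x < 2 * t by lia.
  rewrite memn_ord; apply/undecidedP; split.
    by exists T' => //; rewrite -memn_ord; move: xT'; rewrite Gsym // negbK.
  by exists T => //; rewrite -memn_ord; move: xT; rewrite Gsym.
rewrite -card_powerset -[leqLHS](@card_in_imset _ _ (fun T => T :&: (W :&: H))).
  apply: subset_leq_card; apply/subsetP => z /imsetP[T TG ->].
  by rewrite powersetE subsetIr.
move=> T T' TG TG' /setP eqT.
have eqH x : x \in H -> (x \in T) = (x \in T').
  move=> xH; case xW: (x \in W); first by have := eqT x; rewrite !in_setI xH xW !andbT.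
  apply/idP/idP => xT; apply/negPn/negP => xT'; move/negP: xW; apply; apply/undecidedP.
    by split; [exists T|exists T'].
  by split; [exists T'|exists T].
apply: memn_inj => k kn; case: (ltnP k t) => kt.
  by rewrite !memn_ord eqH // inE.
rewrite (Gsym T) // (Gsym T') //; congr (~~ _).
have kn' : (2 * t).-1 - k < 2 * t by lia.
by rewrite !memn_ord eqH // inE /=; lia.
Qed.

Lemma card_bigcup_le (X Y : finType) (P : {set Y}) (g : Y -> {set X}) :
  #|\bigcup_(y in P) g y| <= \sum_(y in P) #|g y|.
Proof.
elim/big_rec2: _ => [|y A B' _ leA]; first by rewrite cards0.
by apply: leq_trans (leq_card_setU _ _) _; rewrite leq_add2l.
Qed.

(** * Powers of two and the choice of the branching exponent *)

Local Open Scope ring_scope.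

Lemma card_cover_le (R : numDomainType) (X Y : finType) (F : {set X}) (P : {set Y})
    (g : Y -> {set X}) (B : R) :
  (forall x, x \in F -> exists2 y, y \in P & x \in g y) ->
  (forall y, y \in P -> #|g y|%:R <= B) ->
  #|F|%:R <= #|P|%:R * B.
Proof.
move=> FP gB; apply: (@le_trans _ _ (\sum_(y in P) #|g y|%:R)).
  rewrite -natr_sum ler_nat; apply: leq_trans (card_bigcup_le _ _).
  apply: subset_leq_card; apply/subsetP => x /FP[y yP xy].
  by apply/bigcupP; exists y.
by rewrite mulr_natl -sumr_const ler_sum.
Qed.

Lemma pow2D (R : realType) (x y : R) : 2 `^ (x + y) = 2 `^ x * 2 `^ y.
Proof. by rewrite powRD // pnatr_eq0 implybT. Qed.

Lemma ler_pow2 (R : realType) (x y : R) : x <= y -> 2 `^ x <= 2 `^ y :> R.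
Proof. by move=> xy; apply: ler_powR; rewrite // ler1n. Qed.

Lemma pow2_nat (R : realType) n : 2 `^ n%:R = (2 ^ n)%N%:R :> R.
Proof. by rewrite powR_mulrn ?ler0n // natrX. Qed.

Lemma pow2X (R : realType) (x : R) n : (2 `^ x) ^+ n = 2 `^ (x * n%:R).
Proof. by rewrite powRrM powR_mulrn ?powR_ge0. Qed.

Lemma bernoulli (R : realDomainType) (x : R) n : 0 <= x -> 1 + n%:R * x <= (1 + x) ^+ n.
Proof.
move=> x0; elim: n => [|n IHn]; first by rewrite mul0r addr0 expr0.
rewrite exprS; apply: le_trans (_ : (1 + x) * (1 + n%:R * x) <= _).
  have : 0 <= n%:R * x * x by rewrite !mulr_ge0 ?ler0n.
  by rewrite -natr1; nra.
by rewrite ler_wpM2l // addr_ge0.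
Qed.

(** The condition is lam^phi (lam - 1) >= 1. By Bernoulli lam^phi >= phi (lam - 1), so phi > (lam -
    1)^(-2) suffices. *)
Lemma exists_branching_exponent (R : archiRealFieldType) (lam : R) :
  1 < lam -> exists2 phi, (0 < phi)%N & lam ^+ phi + 1 <= lam ^+ phi.+1.
Proof.
move=> lam1; set x := lam - 1.
have x0 : 0 < x by rewrite subr_gt0.
exists (Num.bound (x ^-2)).+1 => //; set n := (Num.bound _).+1.
have nx : 1 <= n%:R * x * x.
  rewrite -mulrA -ler_pdivrMr ?mulr_gt0 // mul1r -expr2.
  apply/ltW; apply: lt_trans (archi_boundP _) _; last by rewrite ltr_nat.
  by rewrite invr_ge0 exprn_ge0 // ltW.
have lamE : 1 + x = lam by rewrite /x addrC subrK.
have := bernoulli n (ltW x0); rewrite lamE => bn.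
rewrite exprS.
have : 1 <= lam ^+ n * x.
  apply: le_trans nx _; rewrite ler_pM2r //; apply: le_trans bn.
  by rewrite lerDr.
by rewrite /x; lra.
Qed.

(** When branching stops, [undecided_stop_bound] with |Q| = (r + 1) phi bounds the number of
    undecided points by (1 + 1/r)(u0 - |Z|), and half of it is the exponent. The factor 2^(|Z|/2)
    paid for the free zone then brings the total to u0/2, up to the 1/r term. *)
Lemma rich_family_bound (R : realType) t m u0 r phi (Q : {set 'I_(2 * t)}) (lam : R) :
  (0 < m)%N -> (3 * m < 2 * t)%N -> (3 * u0 < 2 * t)%N ->
  (forall q, q \in Q -> (0 < q <= u0)%N) -> #|Q| = (r.+1 * phi)%N ->
  (0 < r)%N -> (0 < phi)%N ->
  1 <= lam -> lam ^+ phi + 1 <= lam ^+ phi.+1 ->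
  #|[set T in multiplicity_class t m | Q \subset T]|%:R <=
    lam ^+ (2 * (2 * t - 3 * m)) *
      2 `^ ((u0%:R + (u0%:R - #|free_zone t m|%:R) / r%:R) / 2).
Proof.
move=> m0 m3 u3 Qu cQ r0 phi0 lam1 lamphi.
set Z := free_zone t m; set z : R := #|Z|%:R; set H := lower_half t.
set F := [set T in multiplicity_class t m | _].
(* Fixing the trace of T on the free zone costs 2 ^ (#|Z| / 2) and makes the
   free zone decided. *)
pose g A := [set T in F | T :&: (Z :&: H) == A].
have revE (x : 'I_(2 * t)) : rev_ord x = ((2 * t).-1 - x)%N :> nat.
  by rewrite /=; have := ltn_ord x; clear; lia.
have cZ : #|Z| = (2 * #|Z :&: H|)%N.
  apply: card_sym_set => x; rewrite (memn_set (2 * t) (fun k => 2 * t - 2 * m <= k < 2 * m)%N).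
  by rewrite inE => xZ; have := ltn_ord x; lia.
have r0R : 0 < r%:R :> R by rewrite ltr0n.
have rS : r.+1%:R = r%:R + 1 :> R by rewrite -natr1.
have gB A : A \in powerset (Z :&: H) ->
    #|g A|%:R <= lam ^+ (2 * (2 * t - 3 * m)) * 2 `^ ((1 + r%:R^-1) * (u0%:R - z) / 2).
  move=> _; have gm : g A \subset multiplicity_class t m.
    by apply/subsetP => T; rewrite inE => /andP[]; rewrite inE => /andP[].
  have disj (G : {set {set 'I_(2 * t)}}) : G \subset g A -> [disjoint undecided G & Z].
    move=> /subsetP GA; rewrite disjoint_subset; apply/subsetP => x.
    move=> /undecidedP[[T TG xT] [T' TG' xT']]; apply/negP => /= xZ.
    have tr : T :&: (Z :&: H) = T' :&: (Z :&: H).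
      have := GA _ TG; rewrite inE => /andP[_ /eqP ->].
      by have := GA _ TG'; rewrite inE => /andP[_ /eqP ->].
    have trE y : y \in Z -> y \in H -> (y \in T) = (y \in T').
      by move=> yZ yH; have /setP/(_ y) := tr; rewrite !in_setI yZ yH !andbT.
    case: (ltnP x t) => xt; first by move: xT'; rewrite -trE ?xT // inE.
    have xn := ltn_ord x.
    have symE (S : {set 'I_(2 * t)}) : S \in g A -> (x \in S) = (rev_ord x \notin S).
      move=> /(subsetP gm) /multiplicity_classP[/symmetric_semigroupP[_ _ Ssym] _ _].
      by rewrite -!memn_val Ssym // revE.
    have /negP[] := xT'; rewrite symE ?GA // -trE.
    + by rewrite -symE ?GA.
    + by move: xZ; rewrite !inE revE; clear -xn; lia.
    + by rewrite inE revE; clear -xn xt; lia.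
  have step := @branching_bound R _ lam (2 `^ ((1 + r%:R^-1) * (u0%:R - z) / 2))
    phi (g A) lam1 (powR_ge0 _ _) lamphi.
  apply: le_trans (step _ (g A) (subxx _)) _; last first.
    rewrite ler_wpM2r ?powR_ge0 // ler_weXn2l //.
    by apply: card_undecided_le => //; apply: disj.
  move=> G GA stop; have [->|G0] := eqVneq G set0; first by rewrite cards0 powR_ge0.
  have Gm := subset_trans GA gm.
  have QG T : T \in G -> Q \subset T.
    by move=> /(subsetP GA); rewrite inE => /andP[]; rewrite inE => /andP[].
  have sb := undecided_stop_bound m0 m3 Gm G0 u3 Qu QG (disj _ GA) stop.
  have [|leG hW] := @card_symmetric_family t G.
    by move=> T /(subsetP Gm) /multiplicity_classP[].
  set h := #|_ :&: _| in leG hW.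
  apply: le_trans (_ : 2 `^ h%:R <= _); first by rewrite pow2_nat ler_nat.
  apply: ler_pow2.
  have : (phi * (2 * h * r + r.+1 * #|Z|) <= phi * (r.+1 * u0))%N.
    by move: sb; rewrite hW cQ -/Z; clear; nia.
  rewrite leq_pmul2l // -(ler_nat R) natrD !natrM -/z rS => ineq.
  rewrite -(ler_pM2r r0R) -(ler_pM2r (ltr0n R 2)).
  have -> : (1 + r%:R^-1) * (u0%:R - z) / 2 * r%:R * 2 = (r%:R + 1) * (u0%:R - z) :> R.
    move: r%:R u0%:R (z) r0R => x y w x0; field.
    by rewrite gt_eqF.
  by move: ineq; move: r%:R u0%:R (z) h%:R => x y w k; clear; lra.
apply: le_trans (card_cover_le _ gB) _.
  by move=> T TF; exists (T :&: (Z :&: H)); rewrite ?powersetE ?subsetIr // inE TF eqxx.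
rewrite card_powerset -pow2_nat mulrCA ler_wpM2l ?exprn_ge0 //; first by lra.
rewrite -pow2D ler_pow2 // /z cZ natrM.
rewrite le_eqVlt; apply/orP; left; apply/eqP.
move: r%:R u0%:R (#|Z :&: H|%:R : R) r0R => x y w x0; field.
by rewrite gt_eqF.
Qed.

(** * Semigroups of a given multiplicity *)

Local Open Scope nat_scope.

Lemma symmetric_semigroup_ext t (T T' : {set 'I_(2 * t)}) :
  symmetric_semigroup T -> symmetric_semigroup T' ->
  (forall k, k < t -> memn T k = memn T' k) -> T = T'.
Proof.
move=> /symmetric_semigroupP[_ _ sT] /symmetric_semigroupP[_ _ sT'] eqT.
apply: memn_inj => k kn; case: (ltnP k t) => kt; first exact: eqT.
by rewrite sT // sT' // eqT //; lia.
Qed.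

Lemma leq_expn2r k m n : m <= n -> m ^ k <= n ^ k.
Proof. by case: k => // k mn; rewrite leq_exp2r. Qed.

Lemma bin_leq_expn n k : 'C(n, k) <= n ^ k.
Proof.
rewrite bin_ffactd; apply: leq_trans (leq_div _ _) _.
elim: k n => // k IHk [|n]; first by rewrite ffact0n.
rewrite ffactSS expnS leq_mul2l; apply/orP; right.
by apply: leq_trans (IHk n) (leq_expn2r _ (leqnSn n)).
Qed.

Lemma card_subsets_lt (X : finType) (J : {set X}) K :
  #|[set Q : {set X} | (Q \subset J) && (#|Q| < K)]| <= K * #|J|.+1 ^ K.
Proof.
rewrite -(ler_nat rat) natrM.
pose g (k : 'I_K) := [set Q : {set X} | (Q \subset J) && (#|Q| == k)].
have := @card_cover_le rat _ _ [set Q : {set X} | (Q \subset J) && (#|Q| < K)]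
  [set: 'I_K] g (#|J|.+1 ^ K)%:R%R.
rewrite cardsT card_ord; apply.
  move=> Q; rewrite inE => /andP[QJ QK]; exists (Ordinal QK) => //.
  by rewrite inE QJ /=.
move=> k _; rewrite ler_nat cards_draws; apply: leq_trans (bin_leq_expn _ _) _.
apply: leq_trans (_ : #|J|.+1 ^ k <= _); last by rewrite leq_pexp2l // ltnW.
exact: leq_expn2r.
Qed.

(** * Exponent arithmetic *)

Lemma rich_exponent_le (R : realFieldType) (u e m z F : R) :
  (0 <= e -> 4 * m <= z + F + 1 -> 600 * u + e <= 200 * F -> 3 * m + e = F ->
   1 / 9600 * (2 * e + 2) + (u + (u - z) / 3200) / 2 <= F / 6 - e / 2400 + 1)%R.
Proof. by move=> *; lra. Qed.

(** A pair costs 5/3 bits instead of 2. Cutting at F/3 - e/600 instead of F/3 costs e/600, while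
    about e/120 pairs save e/360. *)
Lemma sparse_exponent_le (R : realFieldType) (u e r F L t' : R) :
  (0 <= e -> L + u + 2 * r <= t' + 1 -> 2 * t' + 1 = F -> e <= 120 * r + 120 ->
   200 * F <= 600 * u + e + 600 ->
   5 / 3 * r + L <= F / 6 - e / 2400 + 2)%R.
Proof. by move=> *; lra. Qed.

Lemma small_exponent_le (R : realFieldType) (e F x : R) :
  (0 <= e -> e <= F -> 8 * x <= F -> x <= F / 6 - e / 2400)%R.
Proof. by move=> *; lra. Qed.

(** Cubing turns this into 27 <= 32. *)
Lemma three_le_pow2 (R : realType) : (3 <= 2 `^ (5 / 3) :> R)%R.
Proof.
rewrite -(@ler_pXn2r _ 3) ?nnegrE ?powR_ge0 // pow2X.
have -> : (5 / 3 * 3%:R = 5%:R :> R)%R by field.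
by rewrite powR_mulrn // -!natrX ler_nat.
Qed.

(** * Rich, sparse and small-multiplicity bounds for one class *)

Section ClassBounds.

Variables (R : realType) (t m e u0 : nat).
Hypotheses (m0 : 0 < m) (defe : 3 * m + e = (2 * t).-1) (t0 : 0 < t).
(** This is the integer part of F/3 - e/600. *)
Hypothesis defu : u0 = (200 * (2 * t).-1 - e) %/ 600.

Let J : {set 'I_(2 * t)} := [set x : 'I_(2 * t) | m <= x < u0.+1].

Let m3 : 3 * m < 2 * t. Proof. by lia. Qed.
Let u3 : 3 * u0 < 2 * t. Proof. by lia. Qed.

Let cardJ : #|J| <= e.+1.
Proof. by rewrite /J card_ord_interval; lia. Qed.

(** Choose Q among the elements of T in J, in at most (e + 1)^K ways, with K = (r + 1) phi and r =
    3200. The value of u0 saves e/1200 on F/6; the base 2^(1/9600) and the 1/r term give back e/4800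
    each. *)
Lemma rich_class_bound phi : 0 < phi ->
  ((2 `^ (1 / 9600)) ^+ phi + 1 <= (2 `^ (1 / 9600)) ^+ phi.+1 :> R)%R ->
  (#|[set T in multiplicity_class t m | (3201 * phi <= #|T :&: J|)%N]|%:R <=
    e.+1%:R ^+ (3201 * phi) *
    2 `^ ((2 * t).-1%:R / 6 - e%:R / 2400 + 1) :> R)%R.
Proof.
move=> phi0 Hphi; set K := 3201 * phi.
pose P := [set Q : {set 'I_(2 * t)} | (Q \subset J) && (#|Q| == K)].
pose g (Q : {set 'I_(2 * t)}) := [set T in multiplicity_class t m | Q \subset T].
apply: (le_trans (@card_cover_le R _ _ _ P g
    (2 `^ ((2 * t).-1%:R / 6 - e%:R / 2400 + 1))%R _ _)).
- move=> T; rewrite inE => /andP[TC].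
  rewrite -bin_gt0 -cards_draws => /card_gt0P[Q].
  rewrite inE => /andP[]; rewrite subsetI => /andP[QT QJ] cQ.
  by exists Q; rewrite inE ?QJ // TC.
- move=> Q; rewrite inE => /andP[/subsetP QJ /eqP cQ].
  have Qu q : q \in Q -> 0 < q <= u0 by move/QJ; rewrite inE; clear -m0; lia.
  have lam1 : (1 <= 2 `^ (1 / 9600) :> R)%R.
    by rewrite -[leLHS](powRr0 2) ler_pow2 // divr_ge0.
  have := rich_family_bound (r := 3200) m0 m3 u3 Qu cQ isT phi0 lam1 Hphi.
  move/le_trans; apply.
  rewrite pow2X -pow2D ler_pow2 //.
  have -> : 2 * t - 3 * m = e.+1 by clear -defe t0; lia.
  have cZ : #|free_zone t m| = 2 * m - (2 * t - 2 * m).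
    by rewrite card_ord_interval; clear -m3; lia.
  have zR : (4 * m%:R <= #|free_zone t m|%:R + (2 * t).-1%:R + 1 :> R)%R.
    by rewrite -[X in (_ + X)%R](mulr1n 1) -natrM -!natrD ler_nat cZ; clear -t0 m3; lia.
  have uR : (600 * u0%:R + e%:R <= 200 * (2 * t).-1%:R :> R)%R.
    by rewrite -!natrM -natrD ler_nat; clear -defu defe; lia.
  have FR : (3 * m%:R + e%:R = (2 * t).-1%:R :> R)%R by rewrite -natrM -natrD defe.
  have eR : ((2 * e.+1)%:R = 2 * e%:R + 2 :> R)%R.
    by rewrite natrM -(addn1 e) (natrD _ e) mulrDr mulr1.
  by rewrite eR; apply: rich_exponent_le zR uR FR; rewrite ler0n.
rewrite ler_wpM2r ?powR_ge0 //.
rewrite -natrX ler_nat cards_draws; apply: leq_trans (bin_leq_expn _ _) _.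
exact: leq_expn2r.
Qed.


(** With the trace on J fixed, only the points of (u0, t) are unknown. The bound 120 r <= e keeps
    the lower points of the r pairs above u0, and 2 r <= m the upper ones below t; each pair has 3
    possible patterns. *)
Lemma sparse_fiber_bound (Q : {set 'I_(2 * t)}) r :
  120 * r <= e -> 2 * r <= m ->
  #|[set T in multiplicity_class t m | T :&: J == Q]| <=
    3 ^ r * 2 ^ (t.-1 - u0 - 2 * r).
Proof.
move=> re rm; pose h := t.-1 - uphalf m; pose w0 := t - m./2.
have hw : h + w0 + m = (2 * t).-1 by rewrite /h /w0; clear -m3 t0 m0; lia.
have hw' : h < w0 by rewrite /h /w0; clear -m3 t0 m0; lia.
have vlow (j : nat) : j < r -> u0 < h - j.
  by rewrite /h; clear -m3 t0 m0 defe defu re rm; lia.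
have whigh (j : nat) : j < r -> w0 + j < t.
  by rewrite /w0; clear -m3 t0 m0 rm; lia.
(* The pairs (h - j, w0 + j), j < r, have sum F - m, so T contains at most one
   point of each; S collects the unpaired points of (u0, t). *)
pose S := [set x : 'I_(2 * t) | (u0 < x < t) && ~~ (h - r < x <= h) && ~~ (w0 <= x < w0 + r)].
have cS : #|S| <= t.-1 - u0 - 2 * r.
  case: (posnP r) => [r0|r0].
    apply: leq_trans (_ : #|[set x : 'I_(2 * t) | u0.+1 <= x < t]| <= _).
      by apply: subset_leq_card; apply/subsetP => x; rewrite !inE => /andP[/andP[]].
    by rewrite card_ord_interval; clear -r0 t0; lia.
  apply: leq_trans (_ : #|[set x : 'I_(2 * t) | u0.+1 <= x < (h - r).+1] :|:
     [set x : 'I_(2 * t) | h.+1 <= x < w0] :|: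
     [set x : 'I_(2 * t) | w0 + r <= x < t]| <= _).
    apply: subset_leq_card; apply/subsetP => x; rewrite !inE.
    by clear; lia.
  apply: leq_trans (leq_card_setU _ _) _.
  apply: leq_trans (leq_add (leq_card_setU _ _) (leqnn _)) _.
  have := vlow r.-1 ltac:(clear -r0; lia); have := whigh r.-1 ltac:(clear -r0; lia).
  rewrite !card_ord_interval; try (rewrite /h /w0; clear; lia).
  by rewrite -/h -/w0; clear -hw' r0; lia.
pose C3 := [set: {ffun 'I_r -> 'I_3}].
(* The only collision is between (true, true), which never occurs, and (true, false). *)
pose code (b : bool * bool) : 'I_3 := if b.1 then inord 1 else if b.2 then inord 2 else ord0.
pose F (T : {set 'I_(2 * t)}) : {ffun 'I_r -> 'I_3} * {set 'I_(2 * t)} :=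
  ([ffun j : 'I_r => code (memn T (h - j), memn T (w0 + j))], T :&: S).
set G := [set T in _ | _].
rewrite -(@card_in_imset _ _ F G).
  apply: leq_trans (_ : #|setX C3 (powerset S)| <= _).
    apply: subset_leq_card; apply/subsetP => z /imsetP[T _ ->].
    by rewrite in_setX inE powersetE subsetIr.
  rewrite cardsX cardsT card_ffun !card_ord card_powerset leq_mul2l.
  by rewrite leq_pexp2l // orbT.
have Gdisj T : T \in G -> forall j : 'I_r, ~~ (memn T (h - j) && memn T (w0 + j)).
  rewrite inE => /andP[/multiplicity_classP[/symmetric_semigroupP[T0 Tadd Tsym] Tm _] _] j.
  (* Otherwise F would be a sum of three elements of T, while 0 in T excludes F by symmetry. *)
  apply/negP => /andP[Tv Tw]; have jr := ltn_ord j.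
  have vl := vlow _ jr.
  have E1 : h - j + (w0 + j) + m = (2 * t).-1 by clear -vl hw; lia.
  have Tvw : memn T (h - j + (w0 + j)) by apply: Tadd => //; clear -E1 t0; lia.
  have := Tadd _ _ Tvw Tm ltac:(clear -E1 t0; lia).
  by rewrite E1 => TF; have := Tsym 0 ltac:(clear -t0; lia); rewrite subn0 TF T0.
move=> T T' TG TG' [/ffunP eqf /setP eqS].
have eqvw (j : 'I_r) : memn T (h - j) = memn T' (h - j) /\ memn T (w0 + j) = memn T' (w0 + j).
  have := eqf j; rewrite !ffunE; have := Gdisj T TG j; have := Gdisj T' TG' j.
  rewrite /code /=; move: (memn T _) (memn T' _) (memn T _) (memn T' _).
  by do 4!case=> //; move=> _ _ /(congr1 val) /=; rewrite ?inordK.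
have := TG; rewrite inE => /andP[/multiplicity_classP[sT Tm Tge] /eqP TJ].
have := TG'; rewrite inE => /andP[/multiplicity_classP[sT' Tm' Tge'] /eqP TJ'].
apply: symmetric_semigroup_ext => // k kt.
have kn : k < 2 * t by clear -kt; lia.
have [->|k0] := posnP k.
  by have /symmetric_semigroupP[-> _ _] := sT; have /symmetric_semigroupP[-> _ _] := sT'.
case: (ltnP k m) => km.
  have none (V : {set 'I_(2 * t)}) :
      (forall a, memn V a -> 0 < a -> m <= a) -> memn V k = false.
    by move=> Vge; apply: contraTF km => Vk; rewrite -leqNgt; exact: Vge.
  by rewrite !none.
case: (leqP k u0) => ku.
  have /setP/(_ (Ordinal kn)) : T :&: J = T' :&: J by rewrite TJ TJ'.
  by rewrite !in_setI !memn_ord [_ \in J]inE /= ltnS km ku !andbT.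
have := eqS (Ordinal kn); rewrite !in_setI [_ \in S]inE /= ku kt /= -!memn_ord.
case: (boolP (h - r < k <= h)) => [kh _|_].
  have kj : h - k < r by clear -kh; lia.
  by have [] := eqvw (Ordinal kj); rewrite /= subKn //; case/andP: kh.
case: (boolP (w0 <= k < w0 + r)) => [kw _|_]; last by rewrite !andbT.
have kj : k - w0 < r by clear -kw; lia.
by have [_] := eqvw (Ordinal kj); rewrite /= subnKC //; case/andP: kw.
Qed.

Lemma sparse_class_bound K :
  (2 * t).-1 <= 60 * m ->
  (#|[set T in multiplicity_class t m | (#|T :&: J| < K)%N]|%:R <=
    (K * e.+2 ^ K)%:R * 2 `^ ((2 * t).-1%:R / 6 - e%:R / 2400 + 2) :> R)%R.
Proof.
move=> m60; pose P := [set Q : {set 'I_(2 * t)} | (Q \subset J) && (#|Q| < K)].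
pose g (Q : {set 'I_(2 * t)}) := [set T in multiplicity_class t m | T :&: J == Q].
set B := (2 `^ _)%R.
apply: (le_trans (@card_cover_le R _ _ _ P g B _ _)).
- move=> T; rewrite inE => /andP[TC cT]; exists (T :&: J).
    by rewrite inE subsetIr.
  by rewrite inE TC /=.
(* As F <= 60 m, 2 r <= e/60 <= m. *)
- move=> Q _; pose r := e %/ 120.
  have re : 120 * r <= e by rewrite /r; clear; lia.
  have rm : 2 * r <= m by clear -re defe m60; lia.
  apply: le_trans (_ : (3 ^ r * 2 ^ (t.-1 - u0 - 2 * r))%:R <= _)%R.
    by rewrite ler_nat sparse_fiber_bound.
  rewrite natrM natrX -pow2_nat.
  apply: (@le_trans _ _ (2 `^ (5 / 3 * r%:R) * 2 `^ ((t.-1 - u0 - 2 * r)%:R)))%R.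
    rewrite ler_wpM2r ?powR_ge0 // -pow2X lerXn2r ?nnegrE ?ler0n ?powR_ge0 //.
    exact: three_le_pow2.
  rewrite -pow2D ler_pow2 //.
  have LR : ((t.-1 - u0 - 2 * r)%:R + u0%:R + 2 * r%:R <= t.-1%:R + 1 :> R)%R.
    rewrite -natrM -!natrD natr1 ler_nat.
    by clear -defu defe re; lia.
  have tR : (2 * t.-1%:R + 1 = (2 * t).-1%:R :> R)%R.
    by rewrite -natrM natr1; congr (_%:R)%R; clear -t0; lia.
  have rR : (e%:R <= 120 * r%:R + 120 :> R)%R.
    rewrite -[X in (_ + X)%R]/(120%:R)%R -natrM -natrD ler_nat /r; clear; lia.
  have uR : (200 * (2 * t).-1%:R <= 600 * u0%:R + e%:R + 600 :> R)%R.
    rewrite -!natrM -!natrD ler_nat; clear -defu defe; lia.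
  by apply: sparse_exponent_le LR tR rR uR; rewrite ler0n.
rewrite ler_wpM2r ?powR_ge0 // ler_nat; apply: leq_trans (card_subsets_lt _ _) _.
by rewrite leq_mul2l leq_expn2r ?orbT // ltnS.
Qed.

(** T is coded by its least element in each class modulo m (its Apery set), with k + 2 values per
    class for k the integer part of F/m. As k >= 60, these are at most 2^(k/8) values, so the class
    has at most 2^(F/8) members. *)
Lemma class_bound_of_small_multiplicity :
  60 * m <= (2 * t).-1 ->
  (#|multiplicity_class t m|%:R <= 2 `^ ((2 * t).-1%:R / 6 - e%:R / 2400) :> R)%R.
Proof.
move=> m60; pose k := (2 * t).-1 %/ m; pose a := k %/ 8.
have km : k * m <= (2 * t).-1 by apply: leq_divM.
have kge : 60 <= k by rewrite /k leq_divRL.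
have ka : k.+2 <= 2 ^ a.
  (* From k <= 8a + 7 one gets k + 2 <= 8a + 9, and k >= 60 gives a >= 7. *)
  suff H b : 7 <= b -> 8 * b + 9 <= 2 ^ b.
    by apply: leq_trans (H a _); rewrite /a; clear -kge; lia.
  elim: b => // b IHb; rewrite leq_eqVlt => /orP[/eqP<- //|/IHb].
  by rewrite expnS; clear; lia.
apply: (@le_trans _ _ ((2 ^ (a * m))%:R)%R).
  rewrite ler_nat expnM; apply: leq_trans (leq_expn2r m ka).
  (* [find] returns k + 1 when the residue class has no element of T in [0, F]. *)
  pose f (T : {set 'I_(2 * t)}) : {ffun 'I_m -> 'I_k.+2} :=
    [ffun i : 'I_m => inord (find (fun j => memn T (i + j * m)) (iota 0 k.+1))].
  have fE T (i : 'I_m) : f T i = find (fun j => memn T (i + j * m)) (iota 0 k.+1) :> nat.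
    by rewrite ffunE inordK // ltnS -[leqRHS](size_iota 0) find_size.
  rewrite -[X in _ <= _ ^ X]card_ord -[X in _ <= X ^ _]card_ord -card_ffun.
  rewrite -(@card_in_imset _ _ f); first exact: max_card.
  have mem_f (T : {set 'I_(2 * t)}) (i : 'I_m) j : T \in multiplicity_class t m ->
      j <= k -> i + j * m < 2 * t -> memn T (i + j * m) = (f T i <= j).
    move=> /multiplicity_classP[/symmetric_semigroupP[_ Tadd _] Tm _] jk ijn.
    rewrite fE; set p := fun j => _; apply/idP/idP => [pj|pj].
      rewrite leqNgt; apply/negP => /(before_find 0); rewrite nth_iota // add0n.
      by rewrite /p pj.
    have hp : has p (iota 0 k.+1) by rewrite has_find size_iota ltnS (leq_trans pj).
    have := nth_find 0 hp; rewrite nth_iota ?add0n; last by rewrite ltnS (leq_trans pj).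
    move: (find _ _) pj => j0 j0j.
    rewrite /p; have [d jE] : exists d, j = j0 + d by exists (j - j0); rewrite subnKC.
    elim: d j jE {jk j0j} ijn => [|d IHd] j -> ijn; first by rewrite addn0.
    move=> Tj0; have -> : i + (j0 + d.+1) * m = i + (j0 + d) * m + m.
      by clear; lia.
    by apply: Tadd => //; [apply: IHd => //|]; clear -ijn; nia.
  move=> T T' TC TC' eqf; apply: memn_inj => x xn.
  have xE : x = Ordinal (ltn_pmod x m0) + x %/ m * m by rewrite addnC -divn_eq.
  have xk : x %/ m <= k by rewrite /k leq_div2r //; clear -xn; lia.
  by rewrite xE !mem_f ?eqf // -xE.
rewrite -pow2_nat ler_pow2 //.
have : (8 * (a * m)%:R <= (2 * t).-1%:R :> R)%R.
  rewrite -natrM ler_nat; apply: leq_trans km; rewrite mulnA leq_mul2r.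
  by rewrite /a mulnC leq_divM orbT.
have : (e%:R <= (2 * t).-1%:R :> R)%R by rewrite ler_nat -defe leq_addl.
by move: (ler0n R e); exact: small_exponent_le.
Qed.

End ClassBounds.

(** * Counting all symmetric semigroups *)

Local Open Scope ring_scope.

Lemma lt1_pow2 (R : realType) (a : R) : 0 < a -> 1 < 2 `^ a :> R.
Proof.
move=> a0; have [|//] := leP (2 `^ a : R) 1.
have [n na] : exists n : nat, 1 <= a * n%:R.
  exists (Num.bound a^-1); rewrite mulrC -ler_pdivrMr // mul1r ltW //.
  by apply: archi_boundP; rewrite invr_ge0 ltW.
move=> le1; have : 2 <= 2 `^ (a * n%:R) :> R.
  by rewrite -[leLHS](powRr1 (ler0n R 2)) ler_pow2.
rewrite -pow2X => /le_trans/(_ (exprn_ile1 n (powR_ge0 _ _) le1)).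
by rewrite (ler_nat R 2 1).
Qed.

(** Bernoulli bounds e + 2 by a constant times mu^e; the K-th power then has rate a K/(K + 1) < a.
    Dividing by K + 1 also covers K = 0. *)
Lemma poly_le_pow2 (R : realType) (a : R) K : 0 < a ->
  exists2 C : R, 0 <= C & forall e : nat, e.+2%:R ^+ K <= C * 2 `^ (a * e%:R).
Proof.
move=> a0; set mu : R := 2 `^ (a / K.+1%:R).
have x0 : 0 < mu - 1 by rewrite subr_gt0 lt1_pow2 // divr_gt0 // ltr0n.
have D0 : 0 <= (mu - 1)^-1 + 2 by rewrite addr_ge0 // invr_ge0 ltW.
exists (((mu - 1)^-1 + 2) ^+ K); first exact: exprn_ge0.
move=> e; apply: (@le_trans _ _ ((((mu - 1)^-1 + 2) * mu ^+ e) ^+ K)).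
  rewrite lerXn2r ?nnegrE ?ler0n ?mulr_ge0 ?exprn_ge0 ?powR_ge0 //.
  have muE : 1 + (mu - 1) = mu by rewrite addrC subrK.
  have := bernoulli e (ltW x0); rewrite muE => be.
  have mu1 : 1 <= mu ^+ e by apply: le_trans be; rewrite lerDl mulr_ge0 ?ler0n ?ltW.
  rewrite -addn2 natrD mulrDl lerD //; last by rewrite -[leLHS]mulr1 ler_pM2l.
  by rewrite mulrC ler_pdivlMr //; apply: le_trans be; rewrite lerDr.
rewrite exprMn ler_wpM2l ?exprn_ge0 // -exprM mulnC /mu pow2X.
apply: ler_pow2; rewrite natrM.
have K1 : 0 < K.+1%:R :> R by rewrite ltr0n.
have -> : a / K.+1%:R * (K%:R * e%:R) = a * e%:R * (K%:R / K.+1%:R).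
  by move: K.+1%:R (K%:R : R) (e%:R : R) K1 => k k' e' k0; field; rewrite gt_eqF.
rewrite -[leRHS]mulr1 ler_wpM2l ?mulr_ge0 ?ler0n //; first exact: ltW.
by rewrite ler_pdivrMr // mul1r ler_nat.
Qed.

(** Half of the saving e/2400 absorbs the polynomial factor; the other half stays as a geometric
    factor. *)
Lemma class_bound (R : realType) :
  exists2 C : R, 0 <= C & forall t m e : nat, (0 < m)%N -> (3 * m + e)%N = (2 * t).-1 ->
    #|multiplicity_class t m|%:R <=
      C * 2 `^ ((2 * t).-1%:R / 6) * 2 `^ (- (1 / 4800)) ^+ e.
Proof.
have [|phi phi0 Hphi] := @exists_branching_exponent R (2 `^ (1 / 9600)).
  by apply: lt1_pow2; rewrite divr_gt0.
set K := (3201 * phi)%N.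
have [|C C0 HC] := @poly_le_pow2 R (1 / 4800) K; first by rewrite divr_gt0.
(* D dominates 2 + 4K, from the rich and sparse bounds together, and 1, from small
   multiplicities. *)
pose D : R := (1 + K%:R) * 4 + 1.
have K0 : 0 <= K%:R :> R by exact: ler0n.
have D0 : 0 <= D by rewrite /D; clear -K0; lra.
exists (D * C); first exact: mulr_ge0.
move=> t m e m0 defe.
have t0 : (0 < t)%N by clear -m0 defe; lia.
set F : R := (2 * t).-1%:R; set X := 2 `^ (F / 6 - e%:R / 2400).
have X0 : 0 <= X by exact: powR_ge0.
have P1 : 1 <= e.+2%:R ^+ K :> R by rewrite exprn_ege1 // ler1n.
have XD k : 2 `^ (F / 6 - e%:R / 2400 + k%:R) = X * (2 ^ k)%N%:R by rewrite pow2D pow2_nat.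
suff H : #|multiplicity_class t m|%:R <= D * e.+2%:R ^+ K * X.
  apply: le_trans H _; rewrite -mulrA -mulrA -[leRHS]mulrA ler_wpM2l //.
  apply: (@le_trans _ _ (C * 2 `^ (1 / 4800 * e%:R) * X)).
    by rewrite ler_wpM2r.
  rewrite -mulrA ler_wpM2l // /X pow2X -!pow2D ler_pow2 // le_eqVlt.
  by apply/orP; left; apply/eqP; clear; move: F => f; field.
have [m60|m60] := leqP (60 * m) (2 * t).-1.
  apply: le_trans (class_bound_of_small_multiplicity R m0 defe m60) _.
  rewrite -/F -/X -[leLHS]mul1r ler_wpM2r //.
  by rewrite -[leLHS]mul1r ler_pM // /D; clear -K0; lra.
have B1 := rich_class_bound m0 defe t0 erefl phi0 Hphi.
have B2 := sparse_class_bound R m0 defe t0 erefl K (ltnW m60).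
set J : {set 'I_(2 * t)} :=
  [set x : 'I_(2 * t) | (m <= x < ((200 * (2 * t).-1 - e) %/ 600).+1)%N] in B1 B2.
rewrite -/K in B1.
have -> : #|multiplicity_class t m| =
    (#|[set T in multiplicity_class t m | (K <= #|T :&: J|)%N]| +
     #|[set T in multiplicity_class t m | (#|T :&: J| < K)%N]|)%N.
  rewrite -[LHS](cardsID [set T : {set 'I_(2 * t)} | (K <= #|T :&: J|)%N]).
  congr (_ + _)%N; apply: eq_card => T; first by rewrite !inE.
  by rewrite [LHS]inE [RHS]inE inE -ltnNge andbC.
rewrite natrD; apply: le_trans (lerD B1 B2) _.
rewrite -/F (XD 1%N) (XD 2%N) -[(2 ^ 1)%N]/2%N -[(2 ^ 2)%N]/4%N natrM natrX.
have P2 : e.+1%:R ^+ K <= e.+2%:R ^+ K :> R.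
  by rewrite lerXn2r ?nnegrE ?ler0n // ler_nat.
have PX : 0 <= e.+2%:R ^+ K * X by rewrite mulr_ge0 // (le_trans ler01).
have PX2 := ler_wpM2r X0 P2.
have KPX := mulr_ge0 K0 PX.
rewrite /D; move: PX PX2 KPX K0; clear.
move: (e.+2%:R ^+ K) (e.+1%:R ^+ K) (K%:R : R) X => p q k x; nra.
Qed.

(** * Summation over multiplicities and the matching lower bound *)

Definition symmetric_semigroups t : {set {set 'I_(2 * t)}} :=
  [set T | symmetric_semigroup T].

(** The integers strictly between F/3 and F/2; the left end is the ceiling of 2t/3. *)
Definition free_interval t : {set 'I_(2 * t)} :=
  [set x : 'I_(2 * t) | (2 * t).+2 %/ 3 <= x < t]%N.

Lemma card_free_interval t : (0 < t)%N -> #|free_interval t| = (t - (2 * t).+2 %/ 3)%N.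
Proof. by move=> t0; rewrite card_ord_interval; lia. Qed.

Lemma card_large_multiplicity t :
  (0 < t)%N ->
  (#|[set T in symmetric_semigroups t |
       [forall x in T, (x == 0 :> nat) || (2 * t <= 3 * x)]]| <=
    2 ^ #|free_interval t|)%N.
Proof.
move=> t0; set S := free_interval t; set G := [set T in _ | _].
rewrite -card_powerset -[leqLHS](@card_in_imset _ _ (fun T => T :&: S)).
  apply: subset_leq_card; apply/subsetP => z /imsetP[T _ ->].
  by rewrite powersetE subsetIr.
move=> T T'; rewrite !inE => /andP[sT /forall_inP Tge] /andP[sT' /forall_inP Tge'] /setP eqTS.
apply: symmetric_semigroup_ext => // k kt.
have kn : (k < 2 * t)%N by clear -kt; lia.
have [->|k0] := posnP k.
  by have /symmetric_semigroupP[-> _ _] := sT; have /symmetric_semigroupP[-> _ _] := sT'.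
rewrite !memn_ord; have := eqTS (Ordinal kn); rewrite !in_setI [_ \in S]inE /= kt andbT.
case: (leqP ((2 * t).+2 %/ 3) k) => [_|k3 _]; first by rewrite !andbT.
have none (V : {set 'I_(2 * t)}) :
    (forall x, x \in V -> (x == 0 :> nat) || (2 * t <= 3 * x)%N) -> (Ordinal kn \in V) = false.
  move=> Vge; apply/negP => /Vge /=.
  by clear -k0 k3; lia.
by rewrite !none.
Qed.

Lemma symmetric_semigroups_cover t :
  (0 < t)%N ->
  symmetric_semigroups t \subset
    [set T in symmetric_semigroups t |
       [forall x in T, (x == 0 :> nat) || (2 * t <= 3 * x)%N]] :|:
    \bigcup_(m in [set: 'I_((2 * t).-1 %/ 3)]) multiplicity_class t m.+1.
Proof.
move=> t0; apply/subsetP => T; rewrite inE => sT; rewrite in_setU !inE sT /=.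
case: (boolP [forall x in T, (x == 0 :> nat) || (2 * t <= 3 * x)%N]) => [//|/=].
case/forall_inPn => x xT; rewrite negb_or -lt0n -ltnNge => /andP[x0 x3].
have exm : exists m, memn T m && (0 < m)%N by exists x; rewrite memn_val xT.
case: (ex_minnP exm) => m /andP[Tm m0] mmin.
have mx : (m <= x)%N by apply: mmin; rewrite memn_val xT.
have mq : (m.-1 < (2 * t).-1 %/ 3)%N by clear -mx x3 m0; lia.
apply/bigcupP; exists (Ordinal mq); first by rewrite inE.
rewrite [nat_of_ord _]/= prednK //.
apply/multiplicity_classP; split=> // a Ta a0.
by apply: mmin; rewrite Ta.
Qed.

Lemma symmetric_semigroups_upper (R : realType) :
  exists2 C : R, 0 < C & forall t, (0 < t)%N ->
    #|symmetric_semigroups t|%:R <= C * 2 `^ ((2 * t).-1%:R / 6).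
Proof.
have [C C0 HC] := class_bound R.
set rho : R := 2 `^ (- (1 / 4800)) in HC.
have rho1 : rho < 1.
  have : 1 < rho^-1 by rewrite /rho -powRN opprK lt1_pow2 // divr_gt0.
  by rewrite invf_gt1 // powR_gt0.
have rho0 : 0 <= rho by apply: powR_ge0.
have d0 : 0 < 1 - rho by rewrite subr_gt0.
have Cd : 0 <= C / (1 - rho) by rewrite divr_ge0 // ltW.
exists (2 + C / (1 - rho)); first by rewrite ltr_wpDr.
move=> t t0; set X := 2 `^ _; have X0 : 0 <= X by exact: powR_ge0.
set q := ((2 * t).-1 %/ 3)%N.
have := subset_leq_card (symmetric_semigroups_cover t0).
rewrite -(ler_nat R) => /le_trans; apply.
have [+ _] := leq_card_setU [set T in symmetric_semigroups t |
       [forall x in T, (x == 0 :> nat) || (2 * t <= 3 * x)%N]]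
  (\bigcup_(m in [set: 'I_q]) multiplicity_class t m.+1).
rewrite -(ler_nat R) => /le_trans; apply.
rewrite natrD mulrDl lerD //.
  apply: le_trans (_ : (2 ^ #|free_interval t|)%:R <= _).
    by rewrite ler_nat card_large_multiplicity.
  rewrite -pow2_nat -[X in X * _](powRr1 (ler0n R 2)) -pow2D ler_pow2 //.
  rewrite -(ler_pM2r (ltr0n R 6)) mulrDl divfK ?pnatr_eq0 //.
  rewrite -natrM mul1r -natrD ler_nat card_free_interval //.
  by clear -t0; lia.
apply: (@le_trans _ _ (\sum_(m in [set: 'I_q]) #|multiplicity_class t m.+1|%:R)).
  by rewrite -natr_sum ler_nat card_bigcup_le.
(* Since 3q <= F, e = F - 3(m + 1) is at least q - (m + 1): a geometric series read backwards. *)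
apply: (@le_trans _ _ (\sum_(m < q) C * X * rho ^+ (q - m.+1))).
  rewrite (eq_bigl xpredT); last by move=> m; rewrite inE.
  apply: ler_sum => m _; have mq := ltn_ord m.
  have [e defe] : exists e, (3 * m.+1 + e = (2 * t).-1)%N.
    by exists ((2 * t).-1 - 3 * m.+1)%N; rewrite subnKC //; move: mq; rewrite /q; clear; lia.
  apply: le_trans (HC t m.+1 e isT defe) _.
  rewrite ler_wpM2l ?mulr_ge0 //.
  apply: ler_wiXn2l => //; first exact: ltW.
  have : (3 * q <= (2 * t).-1)%N by rewrite mulnC leq_divM.
  by move: defe; move: {mq}(m : nat) => i; move: (q); clear=> j; lia.
rewrite -mulr_sumr mulrAC ler_wpM2r // ler_wpM2l //.
rewrite -[leRHS]mul1r ler_pdivlMr // (reindex_inj rev_ord_inj) /=.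
rewrite (eq_bigr (fun i : 'I_q => rho ^+ i)); last first.
  by move=> i _; congr (_ ^+ _); have := ltn_ord i; clear; lia.
by rewrite mulrC -opprB mulNr -subrX1 opprB gerBl exprn_ge0.
Qed.

Local Open Scope nat_scope.

(** Each subset A of the free interval extends to a semigroup by 0 and symmetry. Positive elements
    exceed F/3, so F - (a + b) < F/3 is never in A, which gives closure. *)
Lemma symmetric_semigroups_lower t :
  0 < t -> 2 ^ #|free_interval t| <= #|symmetric_semigroups t|.
Proof.
move=> t0; pose P (A : {set 'I_(2 * t)}) k :=
  [|| k == 0, memn A k | [&& t <= k, k < (2 * t).-1 & ~~ memn A ((2 * t).-1 - k)]].
pose ext (A : {set 'I_(2 * t)}) := [set x : 'I_(2 * t) | P A x].
have extE A k : memn (ext A) k = (k < 2 * t) && P A k by rewrite (memn_set _ (P A)).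
have Age A k : A \in powerset (free_interval t) -> memn A k -> (2 * t <= 3 * k) && (0 < k < t).
  rewrite powersetE => /subsetP AS /memnP[x /AS xS <-]; move: xS; rewrite inE.
  by clear -t0; lia.
rewrite -card_powerset -(@card_in_imset _ _ ext); last first.
  move=> A A' AS AS' eqA; apply: memn_inj => k kn.
  have extA B : B \in powerset (free_interval t) -> memn B k = (0 < k < t) && memn (ext B) k.
    move=> BS; rewrite extE kn andTb /P; have [Bk|Bk] := boolP (memn B k).
      by have /andP[_ ->] := Age _ _ BS Bk; rewrite orbT.
    case: (0 < k < t) / (boolP (0 < k < t)) => // /andP[k0 kt].
    by rewrite eqn0Ngt k0 leqNgt kt.
  by rewrite (extA A) // (extA A') // eqA.
apply: subset_leq_card; apply/subsetP => z /imsetP[A AS ->]; rewrite inE.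
have {}Age k := Age A k AS.
apply/symmetric_semigroupP; split.
- by rewrite extE /P eqxx muln_gt0 t0.
- move=> a b; rewrite !extE => /andP[an Pa] /andP[bn Pb] abn; rewrite abn andTb.
  move: Pa Pb; rewrite {1 2}/P.
  case: (posnP a) => [->|a0]; first by move=> _ Pb; rewrite add0n.
  case: (posnP b) => [->|b0]; first by move=> Pa _; rewrite addn0; apply/orP; right; exact: Pa.
  rewrite !orFb => Pa Pb; rewrite /P; apply/orP; right; apply/orP; right.
  have lowF c : c < 2 * t -> 3 * c < 2 * t -> ~~ memn A c.
    by move=> _ c3; apply/negP => /Age; clear -c3; lia.
  case/orP: Pa => [Aa|/and3P[ta aF Aa]]; case/orP: Pb => [Ab|/and3P[tb bF Ab]].
  + have Ga := Age _ Aa; have Gb := Age _ Ab; apply/and3P; split.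
    * by clear -Ga Gb; lia.
    * by clear -Ga Gb; lia.
    * by apply: lowF; clear -Ga Gb t0; lia.
  + have Ga := Age _ Aa.
    have nF : a + b != (2 * t).-1.
      apply: contra Ab => /eqP <-; suff -> : a + b - b = a by [].
      by rewrite addnK.
    apply/and3P; split; first by clear -tb; lia.
      by clear -nF abn; lia.
    by apply: lowF; clear -Ga tb t0; lia.
  + have Gb := Age _ Ab.
    have nF : a + b != (2 * t).-1.
      by apply: contra Aa => /eqP <-; rewrite addKn.
    apply/and3P; split; first by clear -ta; lia.
      by clear -nF abn; lia.
    by apply: lowF; clear -Gb ta t0; lia.
  + by exfalso; clear -ta tb abn; lia.
- move=> k kn; rewrite !extE kn andTb.
  have -> : (2 * t).-1 - k < 2 * t by clear -t0; lia.
  rewrite andTb /P subKn; last by clear -kn; lia.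
  have noA c : t <= c -> memn A c = false.
    by move=> tc; apply/negbTE/negP => /Age; clear -tc; lia.
  case: (ltnP k t) => kt.
    rewrite (noA ((2 * t).-1 - k)); last by clear -kt; lia.
    case: (posnP k) => [->|k0].
      by rewrite subn0 ltnn andbF; clear -t0; lia.
    by rewrite !(orbF, orFb); clear -k0 kt t0; case: (memn A k); lia.
  rewrite (noA k) //; case: (posnP ((2 * t).-1 - k)) => [k1|k1].
    by clear -k1 kt t0; lia.
  by clear -k1 kt t0; case: (memn A _); lia.
Qed.

(** * From subsets of $[0, 2t - 1]$ to subsets of $\mathbb{Z}_p$ *)

Section Translation.

Variables p s : nat.
Local Notation t := (half_width p s).
Hypotheses (t0 : 0 < t) (defp : p.+1 = 3 * s + 2 * t) (ts : 4 * t <= s).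

Let p1 : 1 < p. Proof. by clear -t0 defp ts; lia. Qed.

Lemma Zp_nat_inj k l : k < p -> l < p -> (k%:R = l%:R :> 'Z_p)%R -> k = l.
Proof. by move=> kp lp /(congr1 val) /=; rewrite !val_Zp_nat // !modn_small. Qed.

Lemma Zp_nat_surj (x : 'Z_p) : exists2 k, k < p & x = (k%:R)%R.
Proof. by exists x; [have := ltn_ord x; rewrite {2}Zp_cast|rewrite natr_Zp]. Qed.

Lemma Zp_natN k : k <= p -> (- k%:R = (p - k)%:R :> 'Z_p)%R.
Proof. by move=> kp; rewrite natrB // pchar_Zp // sub0r. Qed.

Lemma Zp_natDp k : ((k + p)%:R = k%:R :> 'Z_p)%R.
Proof. by rewrite natrD pchar_Zp // addr0. Qed.

(** Membership on representatives k < p: as p = 3s + 2t - 1, the middle interval is [s + 2t, 2s) and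
    -(s + x) is 2s + 2t - 1 - x. *)
Definition in_S_of (T : {set 'I_(2 * t)}) k :=
  [|| s + 2 * t <= k < 2 * s,
      (s <= k < s + 2 * t) && memn T (k - s) |
      (2 * s <= k < 2 * s + 2 * t) && memn T ((2 * s + 2 * t).-1 - k)].

Lemma mem_S_of (T : {set 'I_(2 * t)}) k :
  k < p -> ((k%:R)%R \in @S_of p s T) = in_S_of T k.
Proof.
move=> kp; rewrite /S_of !in_setU /in_S_of; congr [|| _, _ | _].
- apply/imsetP/idP => [[j]|kM].
    rewrite inE => jp /Zp_nat_inj -> //; have := ltn_ord j; move: jp; clear -defp ts; lia.
  have k2s : k < 2 * s by clear -kM; lia.
  by exists (Ordinal k2s) => //; rewrite inE /=; move: kM; clear -defp ts; lia.
- apply/imsetP/andP => [[x xT /Zp_nat_inj kE]|[ks /memnP[x xT xE]]].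
    have xn := ltn_ord x; rewrite kE //; last by clear -xn defp ts; lia.
    by rewrite addKn memn_val; split=> //; clear -xn; lia.
  by exists x => //; rewrite xE subnKC //; case/andP: ks.
- apply/imsetP/andP => [[x xT]|[ks /memnP[x xT xE]]].
    have xn := ltn_ord x;
    rewrite Zp_natN; last by clear -xn defp ts; lia.
    move/Zp_nat_inj => -> //; last by clear -xn defp ts t0; lia.
    have -> : (2 * s + 2 * t).-1 - (p - (s + x)) = x by clear -xn defp ts; lia.
    by rewrite memn_val; split=> //; clear -xn defp ts; lia.
  exists x => //; rewrite Zp_natN; last by rewrite xE; clear -ks defp; lia.
  by congr (_%:R)%R; rewrite xE; clear -ks defp; lia.
Qed.

Lemma memn_in_S_of (T : {set 'I_(2 * t)}) x :
  x < 2 * t -> memn T x = in_S_of T (s + x).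
Proof.
move=> xt; rewrite /in_S_of addKn.
have -> : (s + 2 * t <= s + x < 2 * s) = false by clear -xt; lia.
have -> : s <= s + x < s + 2 * t by clear -xt; lia.
have -> : (2 * s <= s + x < 2 * s + 2 * t) = false by clear -xt ts; lia.
by rewrite orbF.
Qed.

Lemma S_of_inj : injective (@S_of p s).
Proof.
move=> T T' eqS; apply: memn_inj => x xt.
by rewrite !memn_in_S_of // -!mem_S_of ?eqS //; clear -xt ts defp; lia.
Qed.

Lemma card_S_of (T : {set 'I_(2 * t)}) : #|@S_of p s T| = s - 2 * t + 2 * #|T|.
Proof.
pose M := [set x : 'I_p | s + 2 * t <= x < 2 * s].
pose natZ (x : 'I_p) : 'Z_p := (x%:R)%R.
have lowp (x : 'I_(2 * t)) : s + x < p by have := ltn_ord x; clear -defp ts; lia.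
have highp (x : 'I_(2 * t)) : (2 * s + 2 * t).-1 - x < p by clear -defp ts t0; lia.
pose lo (x : 'I_(2 * t)) := Ordinal (lowp x); pose hi x := Ordinal (highp x).
have -> : @S_of p s T = natZ @: (M :|: (lo @: T :|: hi @: T)).
  apply/setP => z; have [k kp ->] := Zp_nat_surj z; rewrite mem_S_of //.
  apply/idP/imsetP => [kS|[x xS /Zp_nat_inj ->]] //.
    exists (Ordinal kp) => //; rewrite !in_setU inE /=.
    case/or3P: kS => [->//|/andP[ks /memnP[x xT xE]]|/andP[ks /memnP[x xT xE]]].
      apply/orP; right; apply/orP; left; apply/imsetP; exists x => //.
      by apply: ord_inj; rewrite /= xE subnKC //; case/andP: ks.
    apply/orP; right; apply/orP; right; apply/imsetP; exists x => //.
    by apply: ord_inj; rewrite /= xE subKn //; clear -ks; lia.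
  rewrite /in_S_of; move: xS; rewrite !in_setU inE.
  case/or3P => [->//|/imsetP[y yT ->]|/imsetP[y yT ->]].
    rewrite /= addKn memn_val yT andbT; have := ltn_ord y.
    by clear; move: (y : nat) (_ && (_ == _)) => i b; lia.
  have yn := ltn_ord y.
  rewrite [nat_of_ord _]/= subKn ?memn_val ?yT ?andbT; last by clear -yn; lia.
  by apply/orP; right; apply/orP; right; clear -yn; lia.
rewrite card_imset; last by move=> x y /Zp_nat_inj xy; apply: ord_inj; apply: xy.
have cM : #|M| = s - 2 * t by rewrite card_ord_interval; clear -defp ts t0; lia.
have clo : #|lo @: T| = #|T|.
  by rewrite card_imset // => x y [] /addnI /ord_inj.
have chi : #|hi @: T| = #|T|.
  rewrite card_imset // => x y [] xy; apply: ord_inj.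
  by have := ltn_ord x; have := ltn_ord y; move: xy; clear; lia.
have dis1 : lo @: T :&: hi @: T = set0.
  apply/setP => z; rewrite in_setI in_set0; apply/negP => /andP[/imsetP[x _ ->]].
  case/imsetP => y _ [] xy; have := ltn_ord x; have := ltn_ord y; move: xy.
  by clear -ts; lia.
have dis2 : M :&: (lo @: T :|: hi @: T) = set0.
  apply/setP => z; rewrite in_setI in_set0; apply/negP => /andP[].
  rewrite inE => zM; rewrite in_setU => /orP[/imsetP[x _ zE]|/imsetP[x _ zE]];
    have := ltn_ord x; move: zM; rewrite zE /=; clear; lia.
rewrite !cardsU dis1 dis2 cards0 cM clo chi.
by clear; lia.
Qed.

Lemma counted_sets_sub : counted_sets p s \subset @S_of p s @: symmetric_semigroups t.
Proof.
apply/subsetP => S; rewrite inE => /andP[/imsetP[T _ ->]].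
case/and5P => _ _ /existsPn sfree /eqP cS sS.
apply: imset_f; rewrite inE.
have cT : #|T| = t by move: cS; rewrite card_S_of; clear -ts; lia.
have T0 : memn T 0.
  rewrite memn_in_S_of; last by clear -t0; lia.
  by rewrite addn0 -mem_S_of //; clear -t0 defp ts; lia.
(* If a + b + c = F, then (s + a) + (s + b) = -(s + c) modulo p. *)
have sf a b c : memn T a -> memn T b -> memn T c -> a + b + c = (2 * t).-1 -> False.
  move=> Ta Tb Tc abc.
  have at_ := memn_lt Ta; have bt := memn_lt Tb; have ct := memn_lt Tc.
  have Sa : ((s + a)%:R)%R \in @S_of p s T.
    by rewrite mem_S_of -?memn_in_S_of //; clear -at_ defp ts; lia.
  have Sb : ((s + b)%:R)%R \in @S_of p s T.
    by rewrite mem_S_of -?memn_in_S_of //; clear -bt defp ts; lia.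
  have Sc : ((s + a + (s + b))%:R)%R \in @S_of p s T.
    rewrite mem_S_of; last by clear -abc t0 defp ts; lia.
    rewrite /in_S_of; apply/orP; right; apply/orP; right.
    have -> : (2 * s + 2 * t).-1 - (s + a + (s + b)) = c by clear -abc t0; lia.
    by rewrite Tc andbT; clear -abc t0; lia.
  have /negP := sfree ((s + a)%:R)%R; apply; rewrite /FiniteQuant.ex_in Sa /=.
  apply/exists_inP; exists ((s + b)%:R)%R => //.
  by apply/exists_inP; exists ((s + a + (s + b))%:R)%R => //; rewrite -natrD.
(* The relation x + (F - x) + 0 = F makes T and its reflection disjoint; having t elements each,
   they fill [0, F]. *)
have revT : @rev_ord (2 * t) @: T = ~: T.
  apply/eqP; rewrite eqEcard; apply/andP; split.
    apply/subsetP => z /imsetP[x xT ->]; rewrite in_setC; apply/negP => rT.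
    rewrite -memn_val in xT; rewrite -memn_val in rT.
    apply: (sf _ _ _ xT rT T0); rewrite /=; have := ltn_ord x; clear; lia.
  rewrite card_imset; last exact: rev_ord_inj.
  by rewrite -(leq_add2l #|T|) cardsC card_ord cT addnn mul2n.
have Tsym a : a < 2 * t -> memn T a = ~~ memn T ((2 * t).-1 - a).
  move=> an; have a'n : (2 * t).-1 - a < 2 * t by clear -t0; lia.
  rewrite (memn_ord _ an) (memn_ord _ a'n).
  have <- : rev_ord (Ordinal an) = Ordinal a'n by apply: ord_inj => /=; clear; lia.
  rewrite -in_setC -revT; apply/idP/imsetP => [aT|[x xT /rev_ord_inj ->]] //.
  by exists (Ordinal an).
apply/symmetric_semigroupP; split=> // a b Ta Tb ab.
rewrite Tsym //; apply/negP => Tc; apply: (sf a b _ Ta Tb Tc).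
by clear -ab; lia.
Qed.

Lemma sum_cases k1 k2 k3 : k1 < p -> k2 < p -> k3 < p ->
  (k1%:R + k2%:R = k3%:R :> 'Z_p)%R -> k1 + k2 = k3 \/ k1 + k2 = k3 + p.
Proof.
move=> k1p k2p k3p; rewrite -natrD; case: (ltnP (k1 + k2) p) => kp.
  by move/Zp_nat_inj => ->; auto.
have -> : k1 + k2 = k1 + k2 - p + p by rewrite subnK.
rewrite Zp_natDp => /Zp_nat_inj -> //; first by right.
by clear -k1p k2p kp; lia.
Qed.

Lemma symmetric_semigroups_counted (T : {set 'I_(2 * t)}) :
  symmetric_semigroup T -> @S_of p s T \in counted_sets p s.
Proof.
move=> sT; have /symmetric_semigroupP[T0 Tadd Tsym] := sT.
rewrite inE imset_f //=.
have TF a b : memn T a -> memn T b -> a + b < 2 * t -> memn T ((2 * t).-1 - (a + b)) = false.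
  by move=> Ta Tb ab; apply: negbTE; rewrite -Tsym // Tadd.
have in_lo k : s <= k < s + 2 * t -> in_S_of T k = memn T (k - s).
  by move=> ks; rewrite [RHS]memn_in_S_of; [congr in_S_of|]; clear -ks; lia.
have in_hi k : 2 * s <= k < 2 * s + 2 * t -> in_S_of T k = memn T ((2 * s + 2 * t).-1 - k).
  move=> ks; rewrite /in_S_of ks.
  have -> : (s + 2 * t <= k < 2 * s) = false by clear -ks; lia.
  by have -> : (s <= k < s + 2 * t) = false by clear -ks ts; lia.
have in_mid k : s + 2 * t <= k < 2 * s -> in_S_of T k by move=> ks; rewrite /in_S_of ks.
have in_cases k : in_S_of T k -> [\/ s + 2 * t <= k < 2 * s,
    s <= k < s + 2 * t /\ memn T (k - s) |
    2 * s <= k < 2 * s + 2 * t /\ memn T ((2 * s + 2 * t).-1 - k)].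
  by case/or3P => [|/andP[]|/andP[]]; [constructor 1|constructor 2|constructor 3].
have in_bound k : in_S_of T k -> s <= k < 2 * s + 2 * t.
  by case/in_cases => [|[]|[]]; clear -ts; lia.
have in_opp k : k <= p -> in_S_of T k -> in_S_of T (p - k).
  move=> kp /in_cases[kM|[kM Tk]|[kM Tk]].
  - by apply: in_mid; clear -kM defp t0; lia.
  - rewrite in_hi; last by clear -kM defp t0; lia.
    by move: Tk; congr (memn T _); clear -kM defp t0; lia.
  - rewrite in_lo; last by clear -kM defp t0; lia.
    by move: Tk; congr (memn T _); clear -kM defp t0; lia.
have cT : #|T| = t.
  have revT : @rev_ord (2 * t) @: T = ~: T.
    apply/setP => x; rewrite in_setC.
    have -> : (x \in T) = ~~ (rev_ord x \in T).
      rewrite -!memn_val Tsym; last exact: ltn_ord.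
      by congr (~~ memn T _); rewrite /=; have := ltn_ord x; clear; lia.
    rewrite negbK; apply/imsetP/idP => [[y yT ->]|xT]; first by rewrite rev_ordK.
    by exists (rev_ord x); rewrite ?rev_ordK.
  have := cardsC T; rewrite -revT card_imset; last exact: rev_ord_inj.
  by rewrite card_ord addnn => cT2; apply: double_inj; rewrite cT2 mul2n.
have sumS x y : x < p -> y < p -> in_S_of T x -> in_S_of T y ->
    forall k, x + y = k \/ x + y = k + p ->
    exists2 u : 'Z_p, u \in @S_of p s T &
      exists2 v, v \in @S_of p s T & (k%:R = u + v)%R.
  move=> xp yp Sx Sy k xyk; exists (x%:R)%R; first by rewrite mem_S_of.
  exists (y%:R)%R; first by rewrite mem_S_of.
  by rewrite -natrD; case: xyk => -> //; rewrite Zp_natDp.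
apply/and5P; split.
- apply/forall_inP => z; have [k kp ->] := Zp_nat_surj z.
  rewrite mem_S_of // => Sk; rewrite Zp_natN 1?ltnW //.
  have kb := in_bound k Sk.
  by rewrite mem_S_of ?in_opp // 1?ltnW //; clear -kb kp t0 ts; lia.
- apply/forall_inP => z; have [k kp ->] := Zp_nat_surj z.
  rewrite in_setC mem_S_of // => Sk.
  suff [u uS [v vS kE]] : exists2 u : 'Z_p, u \in @S_of p s T &
      exists2 v, v \in @S_of p s T & (k%:R = u + v)%R.
    by apply/exists_inP; exists u => //; apply/exists_inP; exists v => //; apply/eqP.
  have Ss : in_S_of T s by rewrite in_lo ?subnn //; clear -t0; lia.
  have sp : s < p by clear -defp t0 ts; lia.
  have Sps := in_opp _ (ltnW sp) Ss.
  have psp : p - s < p by clear -defp t0 ts; lia.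
  case: (ltnP k (s - 2 * t)) => k1.
    have [a2 b2] : 2 * s - 1 < p /\ k + s + 2 * t < p by clear -k1 defp t0 ts; lia.
    apply: (sumS (2 * s - 1) (k + s + 2 * t)) => //.
    + by apply: in_mid; clear -t0 ts; lia.
    + by apply: in_mid; clear -k1; lia.
    + by right; clear -k1 defp t0 ts; lia.
  (* Here k + s >= 2s - 2t falls in the middle interval because 4t <= s. *)
  case: (ltnP k s) => k2.
    have b2 : k + s < p by clear -k2 defp t0 ts; lia.
    apply: (sumS (p - s) (k + s)) => //.
    + by apply: in_mid; clear -k1 k2 ts; lia.
    + by right; clear -sp; lia.
  (* As k - s is not in T, F - (k - s) is, and k = -s - (s + F - (k - s)) modulo p. *)
  case: (ltnP k (s + 2 * t)) => k3.
    have kn : k - s < 2 * t by clear -k2 k3; lia.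
    have Tk : memn T ((2 * t).-1 - (k - s)).
      by rewrite -[memn _ _]negbK -Tsym // -in_lo // k2.
    have [a2 b2] : (2 * s + 2 * t).-1 < p /\ 2 * s + (k - s) < p.
      by clear -kn defp t0 ts; lia.
    apply: (sumS (2 * s + 2 * t).-1 (2 * s + (k - s))) => //.
    + by rewrite in_hi ?subnn //; clear -t0; lia.
    + rewrite in_hi; last by clear -kn; lia.
      by move: Tk; congr (memn T _); clear -kn; lia.
    + by right; clear -k2 k3 defp t0; lia.
  case: (ltnP k (2 * s)) => k4; first by rewrite in_mid // k3 in Sk.
  case: (ltnP k (2 * s + 2 * t)) => k5.
    have Tk : memn T (k - 2 * s).
      have kn : k - 2 * s < 2 * t by clear -k4 k5; lia.
      rewrite Tsym //; move: Sk; rewrite in_hi ?k4 //.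
      by apply: contra; congr (memn T _); clear -k4 k5; lia.
    have b2 : k - s < p by clear -kp; lia.
    apply: (sumS s (k - s)) => //; last by left; clear -k2; lia.
    rewrite in_lo; last by clear -k4 k5; lia.
    by move: Tk; congr (memn T _); clear -k4; lia.
  case: (ltnP k (3 * s)) => k6.
    have b2 : k - s < p by clear -kp; lia.
    apply: (sumS s (k - s)) => //; last by left; clear -k2; lia.
    by apply: in_mid; clear -k5 k6; lia.
  have [a2 b2] : s + 2 * t < p /\ k - (s + 2 * t) < p by clear -kp defp t0 ts; lia.
  apply: (sumS (s + 2 * t) (k - (s + 2 * t))) => //.
  + by apply: in_mid; clear -t0 ts; lia.
  + by apply: in_mid; clear -k6 kp defp t0 ts; lia.
  + by left; clear -k6 ts; lia.
(* Representatives lie in [s, 2s + 2t), so x + y = z without wrapping puts x, y in s + T and z in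
   -(s + T); wrapping is the mirror image. Either way a + b + c = F in T. *)
- apply/negP => /exists_inP[x xS /exists_inP[y yS /exists_inP[z zS /eqP xyz]]].
  have [k1 k1p xE] := Zp_nat_surj x; have [k2 k2p yE] := Zp_nat_surj y.
  have [k3 k3p zE] := Zp_nat_surj z; move: xS yS zS xyz.
  rewrite xE yE zE !mem_S_of // => S1 S2 S3 /sum_cases.
  have B1 := in_bound _ S1; have B2 := in_bound _ S2; have B3 := in_bound _ S3.
  case=> // kE.
  + have [kl1 kl2] : (s <= k1 < s + 2 * t) /\ (s <= k2 < s + 2 * t).
      by clear -B1 B2 B3 kE; lia.
    have kh3 : 2 * s <= k3 < 2 * s + 2 * t by clear -B1 B2 B3 kE; lia.
    rewrite in_lo // in S1; rewrite in_lo // in S2; rewrite in_hi // in S3.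
    have ab : k1 - s + (k2 - s) < 2 * t by clear -kE kl1 kl2 kh3; lia.
    have := TF _ _ S1 S2 ab; move: S3; suff -> : (2 * t).-1 - (k1 - s + (k2 - s)) =
      (2 * s + 2 * t).-1 - k3 by move=> ->.
    by clear -kE kl1 kl2 kh3; lia.
  + have [kl1 kl2] : (2 * s <= k1 < 2 * s + 2 * t) /\ (2 * s <= k2 < 2 * s + 2 * t).
      by clear -B1 B2 B3 kE defp t0; lia.
    have kh3 : s <= k3 < s + 2 * t by clear -B1 B2 B3 kE defp t0; lia.
    rewrite in_hi // in S1; rewrite in_hi // in S2; rewrite in_lo // in S3.
    have ab : (2 * s + 2 * t).-1 - k1 + ((2 * s + 2 * t).-1 - k2) < 2 * t.
      by clear -kE kl1 kl2 kh3 defp t0; lia.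
    have := TF _ _ S1 S2 ab; move: S3.
    suff -> : (2 * t).-1 - ((2 * s + 2 * t).-1 - k1 + ((2 * s + 2 * t).-1 - k2)) = k3 - s.
      by move=> ->.
    by clear -kE kl1 kl2 kh3 defp t0; lia.
- by rewrite card_S_of cT; apply/eqP; clear -ts; lia.
- rewrite mem_S_of; last by clear -defp t0 ts; lia.
  by rewrite in_lo ?subnn //; clear -t0; lia.
Qed.

Lemma card_counted_sets : #|counted_sets p s| = #|symmetric_semigroups t|.
Proof.
rewrite -(card_imset _ S_of_inj); apply: eq_card; apply/subset_eqP/andP; split.
  exact: counted_sets_sub.
apply/subsetP => S /imsetP[T]; rewrite inE => sT ->.
exact: symmetric_semigroups_counted.
Qed.

End Translation.

(** * The count in terms of p and s *)

Local Open Scope ring_scope.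

Theorem theorem1p4 (R : realType) :
  exists (c1 c2 : R) (p0 : nat),
    [/\ 0 < c1, 0 < c2 &
      forall p s : nat, prime p -> (p0 <= p)%N -> ~~ odd s ->
        318 / 1000 * p%:R <= s%:R :> R ->
        s%:R <= (p%:R - 1) / 3 :> R ->
        c1 * 2 `^ ((p%:R - 3 * s%:R) / 6) <= #|counted_sets p s|%:R
          <= c2 * 2 `^ ((p%:R - 3 * s%:R) / 6)].
Proof.
have [c2 c20 upper] := symmetric_semigroups_upper R.
(* The factor 1/2 comes from |[free_interval t]| >= F/6 - 1. The threshold 100 excludes p = 2 and,
   with s >= 0.318 p, yields 4t <= s. *)
exists (2 `^ (-1)), c2, 100%N; split=> //; first exact: powR_gt0.
move=> p s p_prime p_large s_even s_ge s_le.
have ps1 : (318 * p <= 1000 * s)%N.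
  by rewrite -(ler_nat R) !natrM; move: s_ge; lra.
have ps2 : (3 * s + 1 <= p)%N.
  by rewrite -(ler_nat R) natrD natrM; move: s_le; lra.
have p_odd : odd p by case: (even_prime p_prime) => // p2; move: p_large; rewrite p2.
set t := half_width p s.
have defp : p.+1 = (3 * s + 2 * t)%N.
  rewrite /t /half_width; have := odd_double_half p; have := odd_double_half s.
  rewrite p_odd (negPf s_even); clear -ps2; lia.
have t0 : (0 < t)%N by clear -defp ps2; lia.
have ts : (4 * t <= s)%N by clear -defp ps1 p_large; lia.
rewrite (card_counted_sets t0 defp ts).
have -> : p%:R - 3 * s%:R = (2 * t).-1%:R :> R.
  apply/eqP; rewrite subr_eq -natrM -natrD eqr_nat; apply/eqP.
  by clear -defp t0; lia.
rewrite upper // andbT -pow2D.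
apply: (@le_trans _ _ (2 `^ #|free_interval t|%:R)); last first.
  by rewrite pow2_nat ler_nat symmetric_semigroups_lower.
apply: ler_pow2; rewrite addrC lerBlDr -(ler_pM2r (ltr0n R 6)) mulrDl divfK ?pnatr_eq0 //.
rewrite -natrM mul1r -natrD ler_nat card_free_interval //.
by clear -t0; lia.
Qed.
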